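(* Let $M$ be an $n$-dimensional spherically symmetric Riemannian manifold about a point $p\in M$, with metric $dt^{2}+f^{2}(t)\,d\theta^{2}$ in geodesic polar coordinates at $p$, where $f\in C^{2}([0,R])$ satisfies $f(0)=0$, $f'(0)=1$ and $f(t)>0$ for all $t\in(0,R]$. Let $0<r\le R$ and let $B_{M}(r)\subset M$ be the geodesic ball of radius $r$ centered at $p$, with first Dirichlet Laplacian eigenvalue $\lambda_{1}(B_{M}(r))$. For every non-negative function $u\in C^{0}([0,r])$, not identically zero, set $$h(t,u)=\frac{u(t)}{\displaystyle\int_{t}^{r}\int_{0}^{\sigma}\left(\frac{f(s)}{f(\sigma)}\right)^{n-1}u(s)\,ds\,d\sigma},\qquad t\in[0,r).$$ Then $$\sup_{t\in[0,r)}h(t,u)\;\ge\;\lambda_{1}(B_{M}(r))\;\ge\;\inf_{t\in[0,r)}h(t,u)$$ (where the supremum may be $+\infty$). Moreover, equality holds in either of these inequalities if and only if $u$ (extended radially to $B_M(r)$) is a positive first eigenfunction of $B_{M}(r)$ and $\lambda_{1}(B_{M}(r))=h(t,u)$ for all $t\in[0,r)$.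
   Context: Spherically symmetric manifold: for $p\in M$ and a unit vector $\xi\in T_pM$, let $\gamma_\xi(t)=\exp_p(t\xi)$, let $d(\xi)=\sup\{t>0:\mathrm{dist}_M(p,\gamma_\xi(t))=t\}$, and let $\mathcal{D}_p=\{t\xi\in T_pM: |\xi|=1,\ 0\le t<d(\xi)\}$; $\exp_p$ is a diffeomorphism from $\mathcal{D}_p$ onto its image (geodesic coordinates). For a unit vector $\xi$ let $\xi^\perp$ be its orthogonal complement in $T_pM$ and $\tau_t$ the parallel translation along $\gamma_\xi$ from $T_pM$ to $T_{\exp_p(t\xi)}M$. Define $\mathcal{A}(t,\xi):\xi^\perp\to\xi^\perp$ by $\mathcal{A}(t,\xi)\eta=(\tau_t)^{-1}Y(t)$, where $Y$ is the Jacobi field along $\gamma_\xi$ with $Y(0)=0$ and $(\nabla_{\gamma_\xi'}Y)(0)=\eta$. On $\exp_p(\mathcal{D}_p)$ the metric is $ds^2(\exp_p(t\xi))=dt^2+|\mathcal{A}(t,\xi)d\xi|^2$. $M$ is spherically symmetric (about $p$) if $\mathcal{A}(t,\xi)=f(t)I$ for all unit $\xi$, with $f$ independent of $\xi$. Thus the metric is $dt^2+f^2(t)\,d\theta^2$, with $d\theta^2$ the standard metric on the unit sphere $\mathbb{S}^{n-1}\subset T_pM$; the geodesic coordinates are taken to be valid on the closed ball of radius $R$ about $p$. First eigenvalue: $\lambda_1(B_M(r))$ is the smallest real number $\lambda$ for which there exists $v\in C^2(B_M(r))\cap C^0(\overline{B_M(r)})\setminus\{0\}$ with $\triangle v+\lambda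 v=0$ in $B_M(r)$ and $v=0$ on $\partial B_M(r)$, where $\triangle$ is the Laplace-Beltrami operator of $M$ (so $-\triangle$ is non-negative); such a $v$ for $\lambda=\lambda_1(B_M(r))$ is called a first eigenfunction. ''Positive'' means positive in the open ball $B_M(r)$. Radial extension: the radial extension of $u$ is the function $\tilde u(\exp_p(t\eta))=u(t)$ for $\eta\in\mathbb{S}^{n-1}\subset T_pM$ a unit vector and $t\in[0,r]$. *)

(* Defs.v *)
From mathcomp Require Import all_boot all_order all_algebra.
From mathcomp Require Import all_classical all_reals all_analysis.

Set Implicit Arguments.
Unset Strict Implicit.
Unset Printing Implicit Defensive.

Import Order.TTheory GRing.Theory Num.Theory.
Import numFieldNormedType.Exports.

Local Open Scope classical_set_scope.
Local Open Scope ring_scope.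

(* The tangent space T_pM is 'rV[R]_n with its standard inner product, the     *)
(* coordinates being taken in an orthonormal basis.  The closed geodesic ball  *)
(* of radius Rad about p is identified, through exp_p, with the closed         *)
(* Euclidean ball of radius Rad in T_pM, and the Riemannian metric with a      *)
(* field of Gram matrices g : 'rV_n -> 'M_n over that ball; the point p is 0   *)
(* and the geodesic spheres about p are the Euclidean spheres about 0.         *)

Section EuclideanSpace.
Variables (R : realType) (n : nat).

Definition dotv (x y : 'rV[R]_n) : R := \sum_(i < n) x 0 i * y 0 i.

(* The library norm `|x| on 'rV[R]_n is the sup norm (same topology). *)
Definition enorm (x : 'rV[R]_n) : R := Num.sqrt (dotv x x).

Definition geo_ball (r : R) : set 'rV[R]_n := [set x | enorm x < r].
Definition geo_cball (r : R) : set 'rV[R]_n := [set x | enorm x <= r].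
Definition geo_sphere (r : R) : set 'rV[R]_n := [set x | enorm x = r].

Definition basis_vec (i : 'I_n) : 'rV[R]_n := delta_mx 0 i.

(* Meant for open U only. *)
Definition C2_open (U : set 'rV[R]_n) (v : 'rV[R]_n -> R) : Prop :=
  forall x, U x ->
    {for x, continuous v} /\
    forall i : 'I_n,
      derivable v x (basis_vec i) /\
      {for x, continuous ('D_(basis_vec i) v)} /\
      forall j : 'I_n,
        derivable ('D_(basis_vec i) v) x (basis_vec j) /\
        {for x, continuous ('D_(basis_vec j) ('D_(basis_vec i) v))}.

End EuclideanSpace.

Section RealFunctions.
Variable R : realType.

(* Derivative relative to A: one-sided at the end points of an interval. *)
Definition is_derive_within (A : set R) (f : R -> R) (x l : R) : Prop :=
  (f y - f x) / (y - x) @[y --> within A x^'] --> l.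

Definition C2_within (A : set R) (f : R -> R) : Prop :=
  exists f1 f2 : R -> R,
    [/\ forall x, A x -> is_derive_within A f x (f1 x),
        forall x, A x -> is_derive_within A f1 x (f2 x)
      & {within A, continuous f2}].

End RealFunctions.

Section Riemannian.
Variables (R : realType) (n : nat).

Definition metric_form (g : 'rV[R]_n -> 'M[R]_n) (x v w : 'rV[R]_n) : R :=
  (v *m g x *m w^T) 0 0.

(* The pull-back of g under polar coordinates (t, theta) |-> t theta is        *)
(* dt^2 + f(t)^2 dtheta^2: the tangent vector (a, xi) of ]0, Rad] x S^(n-1) at *)
(* (t, theta), where xi is orthogonal to theta, is sent to a theta + t xi.     *)
(* At p the metric is the inner product of T_pM.                               *)
Definition spherically_symmetric (g : 'rV[R]_n -> 'M[R]_n) (f : R -> R)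
    (Rad : R) : Prop :=
  g 0 = 1%:M /\
  forall (t : R) (theta xi eta : 'rV[R]_n) (a b : R),
    0 < t <= Rad -> enorm theta = 1 -> dotv theta xi = 0 ->
    dotv theta eta = 0 ->
    metric_form g (t *: theta) (a *: theta + t *: xi) (b *: theta + t *: eta)
    = a * b + f t ^+ 2 * dotv xi eta.

(* (det g)^(-1/2) sum_i d_i ((det g)^(1/2) sum_j g^(ij) d_j v) *)
Definition laplace_beltrami (g : 'rV[R]_n -> 'M[R]_n) (v : 'rV[R]_n -> R)
    (x : 'rV[R]_n) : R :=
  (Num.sqrt (\det (g x)))^-1 *
  \sum_(i < n) 'D_(basis_vec R i)
    (fun y => Num.sqrt (\det (g y)) *
              \sum_(j < n) invmx (g y) i j * 'D_(basis_vec R j) v y) x.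

Definition dirichlet_eigenfunction (g : 'rV[R]_n -> 'M[R]_n) (r lambda : R)
    (v : 'rV[R]_n -> R) : Prop :=
  [/\ C2_open (geo_ball r) v,
      {within geo_cball r, continuous v},
      exists2 x, geo_cball r x & v x != 0,
      forall x, geo_ball r x -> laplace_beltrami g v x + lambda * v x = 0
    & forall x, geo_sphere r x -> v x = 0].

Definition dirichlet_eigenvalue (g : 'rV[R]_n -> 'M[R]_n) (r lambda : R) : Prop :=
  exists v, dirichlet_eigenfunction g r lambda v.

Definition is_lambda1 (g : 'rV[R]_n -> 'M[R]_n) (r lambda1 : R) : Prop :=
  dirichlet_eigenvalue g r lambda1 /\
  forall mu, dirichlet_eigenvalue g r mu -> lambda1 <= mu.

Definition first_eigenfunction (g : 'rV[R]_n -> 'M[R]_n) (r : R)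
    (v : 'rV[R]_n -> R) : Prop :=
  exists2 lambda1, is_lambda1 g r lambda1 &
    dirichlet_eigenfunction g r lambda1 v.

Definition positive_first_eigenfunction (g : 'rV[R]_n -> 'M[R]_n) (r : R)
    (v : 'rV[R]_n -> R) : Prop :=
  first_eigenfunction g r v /\ forall x, geo_ball r x -> 0 < v x.

Definition radial_extension (u : R -> R) : 'rV[R]_n -> R := fun x => u (enorm x).

End Riemannian.

(* The value at sigma = 0 of the outer integrand is irrelevant: the inner      *)
(* integral is then over a point.                                              *)
Definition barta_quotient (R : realType) (n : nat) (f : R -> R) (r : R)
    (u : R -> R) (t : R) : R :=
  u t /
  \int[@lebesgue_measure R]_(sigma in `[t, r])
    \int[@lebesgue_measure R]_(s in `[0, sigma])
      ((f s / f sigma) ^+ n.-1 * u s).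

(* Main.v *)
Require Import Defs.
From mathcomp Require Import all_boot all_order all_algebra.
From mathcomp Require Import all_classical all_reals all_analysis.
From HB Require Import structures.
From mathcomp Require Import ring lra.

(* Write w(t) for the double integral in the denominator of h.  Its radial
   extension solves the Poisson equation with right-hand side -u and vanishes on
   the boundary, so h = u / w compares u with lambda1 w.  If p is a positive
   radial first eigenfunction, Green's identity in the variable t says that the
   integral of f^(n-1) p (u - lambda1 w) over [0, r] vanishes; hence if
   u - lambda1 w has a sign, it is zero, which gives both inequalities and the
   equality case.

   It remains to find p.  For each mu the solution of the radial equation with
   value 1 at the centre is a power series in mu.  Let m be the supremum of the
   mu >= 0 for which this solution is positive on [0, r].  The maximum principle,
   applied to the quotient of an arbitrary (not necessarily radial) Dirichlet
   eigenfunction by such a positive solution, shows mu <= lambda1, so m <= lambda1.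
   By continuity in mu the solution for m is non-negative and has a zero; being
   strictly decreasing in t it vanishes exactly at r, so m is a Dirichlet
   eigenvalue and m = lambda1. *)

Set Implicit Arguments.
Unset Strict Implicit.
Unset Printing Implicit Defensive.

Import Order.TTheory GRing.Theory Num.Theory.
Import numFieldNormedType.Exports.

Local Open Scope classical_set_scope.
Local Open Scope ring_scope.

(** * One-variable calculus *)

(** Two obstacles shape the proof. First, [is_lambda1] minimises over all C^2 eigenfunctions, so a
    radial solution must be compared with functions that are not radial. This is done in Cartesian
    coordinates of T_pM, where the coefficients of the Laplacian are only continuous at the centre:
    f(t)/t need not be a smooth function of the point. The divergence is therefore expanded only at
    a point where the gradient of the function at hand vanishes, namely at a local maximum of the
    difference between the eigenfunction and a multiple of the radial solution. Second, the radial
    equation is singular at t = 0. It is replaced by its integrated form: the flux of f^(n-1) q is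
    divided by f^(n-1) and integrated again. The centre then enters only through limits such as
    W'(t)/t -> q(0)/n. For the eigenvalue equation the integrated form is a Volterra equation, whose
    iterated series converges like an exponential for every value of the parameter; the same
    majorant gives continuity in the parameter, uniformly in t. *)

Lemma near_eq_continuous {T U : topologicalType} (f g : T -> U) (x : T) :
  (\forall y \near x, f y = g y) ->
  {for x, continuous f} -> {for x, continuous g}.
Proof.
move=> fg cf; have fgx : f x = g x := nbhs_singleton fg.
have {}cf : f @ x --> g x by rewrite -fgx; exact: cf.
by apply: cvg_trans cf; apply: near_eq_cvg.
Qed.

Section DerivativeRules.
Context {R : realType} {V : normedModType R}.
Implicit Types (f g : V -> R) (x v : V).

Lemma is_derive_lineP f x v (l : R) :
  is_derive x v f l <-> is_derive (0 : R) 1 (fun h : R => f (h *: v + x)) l.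
Proof.
have E : 'D_v f x = 'D_1 (fun h : R => f (h *: v + x)) 0.
  rewrite /derive; set g1 := fun h => h^-1 *: _; set g2 := fun h => h^-1 *: _.
  suff -> : g1 = g2 by [].
  by rewrite funeqE /g1 /g2 => h /=; rewrite addr0 scale0r add0r [_%:A]mulr1.
split=> -[d e]; apply: DeriveDef.
- exact: (derivable1P f x v).1.
- by rewrite -E.
- exact: (derivable1P f x v).2.
- by rewrite E.
Qed.

Lemma is_derive_mul f g x v (df dg : R) :
  is_derive x v f df -> is_derive x v g dg ->
  is_derive x v (fun y => f y * g y) (df * g x + f x * dg).
Proof.
move=> dfx dgx; apply: is_derive_eq (is_deriveM dfx dgx) _.
by rewrite addrC [g x *: _]mulrC.
Qed.

Lemma is_derive_exp f n x v (df : R) :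
  is_derive x v f df ->
  is_derive x v (fun y => f y ^+ n) (n%:R * f x ^+ n.-1 * df).
Proof.
move=> dfx; have := @is_deriveX _ _ f n x v df dfx.
by rewrite exprfctE.
Qed.

Lemma is_derive_inv f x v (df : R) : f x != 0 ->
  is_derive x v f df ->
  is_derive x v (fun y => (f y)^-1) (- (df / f x ^+ 2)).
Proof.
move=> f0 dfx; apply: DeriveDef; first exact: derivableV.
by rewrite deriveV// derive_val /GRing.scale/= mulNr mulrC.
Qed.

Lemma is_derive_comp (F : R -> R) g x v (dF dg : R) :
  is_derive x v g dg -> is_derive (g x) 1 F dF ->
  is_derive x v (fun y => F (g y)) (dF * dg).
Proof.
move=> /is_derive_lineP dgx dFx; apply/is_derive_lineP.
set k := (fun h : R => g (h *: v + x)) in dgx *.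
have k0 : k 0 = g x by rewrite /k scale0r add0r.
have dFk : is_derive (k 0) 1 F dF by rewrite k0.
exact: is_derive1_comp.
Qed.

End DerivativeRules.

Section OneVariable.
Context {R : realType}.
Implicit Types (F G : R -> R) (r t : R).
Local Notation mu := (@lebesgue_measure R).

Lemma cvgXn (T : Type) (F : set_system T) (FF : Filter F) (g : T -> R) (l : R) n :
  g x @[x --> F] --> l -> g x ^+ n @[x --> F] --> l ^+ n.
Proof.
exact: (@continuous_cvg _ _ _ F FF g (fun y => y ^+ n) l (@exprn_continuous R n l)).
Qed.

Lemma cvg_bigsum (T : Type) (F : set_system T) (FF : Filter F) (I : Type)
    (s : seq I) (g : I -> T -> R) (l : I -> R) :
  (forall i, g i x @[x --> F] --> l i) ->
  (\sum_(i <- s) g i x) @[x --> F] --> \sum_(i <- s) l i.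
Proof.
move=> gl; elim: s => [|i s IH].
  by rewrite big_nil; under eq_fun do rewrite big_nil; exact: cvg_cst.
by rewrite big_cons; under eq_fun do rewrite big_cons; exact: cvgD.
Qed.

Lemma within_continuous_subitv (a b c d : R) G : a <= c -> d <= b ->
  {within `[a, b], continuous G} -> {within `[c, d], continuous G}.
Proof.
move=> ac db; apply: continuous_subspaceW => x /=; rewrite !in_itv/=.
by move=> /andP[cx xd]; rewrite (le_trans ac cx) (le_trans xd db).
Qed.

Lemma within_continuous_at (a b t : R) G : a < t < b ->
  {within `[a, b], continuous G} -> {for t, continuous G}.
Proof.
move=> /andP[at_ tb] cG.
have := cG; rewrite continuous_within_itvP ?(lt_trans at_ tb)// => -[+ _ _].
by apply; rewrite in_itv/= at_.
Qed.

Lemma within_continuous_eq0 (a b : R) G : a < b ->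
  {within `[a, b], continuous G} -> {in `]a, b[, forall t, G t = 0} ->
  {in `[a, b], forall t, G t = 0}.
Proof.
move=> ab; rewrite continuous_within_itvP// => -[_ ca cb] G0 t.
rewrite in_itv/= => /andP[]; rewrite le_eqVlt => /predU1P[<-|at_].
  by move=> _; apply: (cvg_unique (@Rhausdorff R) ca); apply: cvg_near_cst;
    near=> x; apply: G0; rewrite in_itv/=; apply/andP; split.
rewrite le_eqVlt => /predU1P[->|tb]; last by apply: G0; rewrite in_itv/= at_.
apply: (cvg_unique (@Rhausdorff R) cb); apply: cvg_near_cst.
near=> x; by apply: G0; rewrite in_itv/=; apply/andP; split.
Unshelve. all: by end_near. Qed.

Lemma deriv_ge0_le (a b : R) F G : a <= b ->
  {within `[a, b], continuous F} ->
  (forall t, a < t < b -> is_derive t 1 F (G t)) ->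
  (forall t, a < t < b -> 0 <= G t) -> F a <= F b.
Proof.
move=> ab cF dF G0; apply: (@ger0_derive1_ndecr _ F a b) => //.
- by move=> x; rewrite in_itv/= => /dF d; exact: ex_derive.
- move=> x; rewrite in_itv/= => xab; rewrite derive1E.
  by have d := dF _ xab; rewrite derive_val G0.
Qed.

(** [F] is nondecreasing, so the reversed inequality between its end values makes it constant. This
    plays the role of the principle that a non-negative integrand with zero integral vanishes. *)
Lemma deriv_ge0_eq0 (a b : R) F G : a <= b ->
  {within `[a, b], continuous F} ->
  (forall t, a < t < b -> is_derive t 1 F (G t)) ->
  (forall t, a < t < b -> 0 <= G t) -> F b <= F a ->
  forall t, a < t < b -> G t = 0.
Proof.
move=> ab cF dF G0 Fba t tab; have /andP[at_ tb] := tab.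
have mono x y : a <= x -> x <= y -> y <= b -> F x <= F y.
  move=> ax xy yb; apply: (@deriv_ge0_le x y F G) => //.
  - exact: within_continuous_subitv cF.
  - by move=> z /andP[xz zy]; apply: dF; rewrite (le_lt_trans ax xz) (lt_le_trans zy yb).
  - by move=> z /andP[xz zy]; apply: G0; rewrite (le_lt_trans ax xz) (lt_le_trans zy yb).
have cst x : a <= x <= b -> F x = F a.
  move=> /andP[ax xb]; apply/eqP; rewrite eq_le (mono a x)// andbT.
  by rewrite (le_trans _ Fba)// mono.
have dt := dF _ tab.
rewrite -(@derive_val _ _ _ _ _ _ _ dt) -[RHS](@derive_cst _ R R (F a) t 1).
apply: near_eq_derive; near=> x; apply: cst.
by apply/andP; split; apply/ltW; near: x; [exact: lt_nbhsr|exact: lt_nbhsl].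
Unshelve. all: by end_near. Qed.

(** Integrals are mostly handled through this characterisation and [primitive_unique], so that
    linearity and bounds become statements about derivatives. The derivative is taken in the open
    interval because [G] is controlled on [0, r] only. *)
Definition primitive_on r G F := [/\ F 0 = 0, {within `[0, r], continuous F} &
  forall t, 0 < t < r -> is_derive t 1 F (G t)].

Lemma Rintegral_primitive r G : 0 <= r -> {within `[0, r], continuous G} ->
  primitive_on r G (fun t => \int[mu]_(s in `[0, t]) G s).
Proof.
move=> r0 cG.
have iG : mu.-integrable `[0, r] (EFin \o G).
  by apply: continuous_compact_integrable => //; exact: segment_compact.
split.
- by rewrite set_itv1 Rintegral_set1.
- exact: parameterized_integral_continuous.
- move=> t /andP[t0 tr].
  have [] := @continuous_FTC1_closed _ G 0 t r tr iG t0.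
    by apply: within_continuous_at cG; rewrite t0.
  by rewrite derive1E => d <-; exact: derivableP.
Qed.

Lemma primitive_unique r G F1 F2 : primitive_on r G F1 -> primitive_on r G F2 ->
  forall t, 0 <= t <= r -> F1 t = F2 t.
Proof.
move=> [F10 cF1 dF1] [F20 cF2 dF2] t /andP[t0 tr].
move: t0; rewrite le_eqVlt => /predU1P[<-|t0]; first by rewrite F10 F20.
have c : {within `[0, t], continuous (F1 - F2)}.
  apply: (@within_continuous_subitv 0 r) => // x.
  by apply: cvgB; [exact: cF1|exact: cF2].
have [x xt|x xt] := @MVT _ (F1 - F2) (fun=> 0) 0 t t0 _ c.
  have dx : 0 < x < r by move: xt; rewrite in_itv/= => /andP[-> /lt_le_trans->].
  by apply: is_derive_eq (is_deriveB (dF1 _ dx) (dF2 _ dx)) _; rewrite subrr.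
rewrite mul0r !fctE F10 F20 subrr subr0 => /eqP.
by rewrite subr_eq0 => /eqP.
Qed.

End OneVariable.

(** * The radial Poisson equation *)

Section RadialPotential.
Context {R : realType}.
Variables (N : nat) (r : R) (f f1 : R -> R).
Hypothesis r_gt0 : 0 < r.
Hypothesis f0 : f 0 = 0.
Hypothesis cf : {within `[0, r], continuous f}.
Hypothesis f_gt0 : forall t : R, 0 < t <= r -> 0 < f t.
Hypothesis df : forall t : R, 0 < t < r -> is_derive t 1 f (f1 t).
Hypothesis f1_0 : f1 t @[t --> 0^'+] --> (1 : R).
Local Notation mu := (@lebesgue_measure R).

Let cvg0 (G : R -> R) : {within `[0, r], continuous G} -> G t @[t --> 0^'+] --> G 0.
Proof. by rewrite continuous_within_itvP// => -[]. Qed.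

Lemma warping_ratio_cvg1 : f t / t @[t --> 0^'+] --> (1 : R).
Proof.
apply: (@lhopital_at_right _ f f1 id (fun=> 1) 0 r) => //.
- by rewrite -{2}f0; exact: cvg0.
- exact: (@cvg_at_right_filter _ _ id).

- by under eq_cvg do rewrite divr1.
Qed.

(** For N = n - 1 the Laplacian of a radial function W is f^(-N) (f^N W')'. Hence
    [radial_potential q] is the radial W with Laplacian [q] and W(0) = W'(0) = 0, found by two
    integrations, and [radial_slope q] is W'. *)
Definition radial_flux (q : R -> R) (t : R) := \int[mu]_(s in `[0, t]) (f s ^+ N * q s).
Definition radial_slope q t := radial_flux q t / f t ^+ N.
Definition radial_potential q t := \int[mu]_(s in `[0, t]) radial_slope q s.

Section Fixed.
Variable q : R -> R.
Hypothesis cq : {within `[0, r], continuous q}.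

Lemma flux_primitive : primitive_on r (fun s => f s ^+ N * q s) (radial_flux q).
Proof.
apply: Rintegral_primitive; first exact: ltW.
move=> x; apply: cvgM; last exact: cq.
by apply: cvgXn; exact: cf.
Qed.

Lemma flux_quotient_cvg : radial_flux q t / t ^+ N.+1 @[t --> 0^'+] --> q 0 / N.+1%:R.
Proof.
have [F0 cF dF] := flux_primitive.
apply: (@lhopital_at_right _ _ (fun s => f s ^+ N * q s) _ (fun t => N.+1%:R * t ^+ N) 0 r) => //.
- move=> x _; have d := @is_derive_exp R R id N.+1 x 1 1 (is_derive_id x 1).
  by apply: is_derive_eq d _; rewrite mulr1.
- by rewrite -{2}F0; exact: cvg0.
- apply: cvg_at_right_filter.
  have := @cvgXn R R (nbhs (0:R)) _ id 0 N.+1 cvg_id; rewrite expr0n; exact.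
- move=> x; rewrite in_itv/= => /andP[x0 _].
  by rewrite mulf_neq0// ?pnatr_eq0// expf_neq0// gt_eqF.
- have : (f t / t) ^+ N * q t / N.+1%:R @[t --> 0^'+] --> 1 ^+ N * q 0 / N.+1%:R.
    apply: cvgM; last exact: cvg_cst.
    apply: cvgM; last exact: cvg0.
    exact: cvgXn warping_ratio_cvg1.
  rewrite expr1n mul1r; apply: cvg_trans; apply: near_eq_cvg; near=> t.
  rewrite expr_div_n -!mulrA invfM; congr (_ * _).
  by rewrite mulrCA [RHS]mulrA [in RHS]mulrC mulrCA.
Unshelve. all: by end_near. Qed.

(** L'Hospital's rule gives the order of the flux at 0, and (f(t)/t)^N tends to 1. For N = n - 1 the
    limit q(0)/n says that the n second derivatives of the potential at the centre share the
    Laplacian equally. *)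
Lemma slope_quotient_cvg : radial_slope q t / t @[t --> 0^'+] --> q 0 / N.+1%:R.
Proof.
have : radial_flux q t / t ^+ N.+1 / (f t / t) ^+ N @[t --> 0^'+] --> q 0 / N.+1%:R / 1 ^+ N.
  apply: cvgM; first exact: flux_quotient_cvg.
  apply: cvgV; first by rewrite expr1n oner_neq0.
  exact: cvgXn warping_ratio_cvg1.
rewrite expr1n divr1; apply: cvg_trans; apply: near_eq_cvg; near=> t.
have t0 : t != 0 by rewrite gt_eqF.
have ft0 : f t != 0 by rewrite gt_eqF// f_gt0//; apply/andP; split => //; apply/ltW.
rewrite /radial_slope expr_div_n exprS; field.
by rewrite t0 !expf_neq0.
Unshelve. all: by end_near. Qed.

Lemma slope0 : radial_slope q 0 = 0.
Proof. by rewrite /radial_slope; have [-> _ _] := flux_primitive; rewrite mul0r. Qed.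

Lemma slope_derive (t : R) : 0 < t < r ->
  is_derive t 1 (radial_slope q) (q t - N%:R * f1 t / f t * radial_slope q t).
Proof.
move=> /[dup] t0r /andP[t0 tr]; have ft0 : f t != 0 by rewrite gt_eqF// f_gt0// t0 ltW.
have [_ _ /(_ _ t0r) dF] := flux_primitive; have dft := df t0r.
have mt0 : f t ^+ N != 0 by rewrite expf_neq0.
have dm := @is_derive_inv _ _ (fun y => f y ^+ N) _ _ _ mt0 (is_derive_exp N dft).
apply: is_derive_eq (is_derive_mul dF dm) _.
rewrite /radial_slope; case: N => [|k] /=.
  by rewrite !expr0 !mulr0n !(mul0r, oppr0, mulr0, mul1r, mulr1, invr1, addr0, subr0).
by rewrite !exprS; field; rewrite ft0 expf_neq0.
Qed.

Lemma slope_continuous : {within `[0, r], continuous (radial_slope q)}.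
Proof.
have [_ cF _] := flux_primitive.
rewrite continuous_within_itvP//; split.
- move=> t; rewrite in_itv/= => t0r; apply: differentiable_continuous.
  by apply/derivable1_diffP; have d := slope_derive t0r; exact: ex_derive.
- rewrite slope0.
  have : radial_slope q t / t * t @[t --> 0^'+] --> q 0 / N.+1%:R * 0.
    apply: cvgM; first exact: slope_quotient_cvg.
    exact: (@cvg_at_right_filter _ _ id).
  rewrite mulr0; apply: cvg_trans; apply: near_eq_cvg; near=> t.
  by rewrite divfK// gt_eqF.
- move: cF cf; rewrite !continuous_within_itvP// => -[_ _ cFr] [_ _ cfr].
  apply: cvgM => //; apply: cvgV.
    by rewrite expf_neq0// gt_eqF// f_gt0// r_gt0/=.
  exact: cvgXn cfr.
Unshelve. all: by end_near. Qed.

Lemma potential_primitive : primitive_on r (radial_slope q) (radial_potential q).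
Proof. by apply: Rintegral_primitive; [exact: ltW|exact: slope_continuous]. Qed.

End Fixed.
End RadialPotential.

(** * Differentiability and the maximum principle *)

Section LineDerivative.
Context {R : realType} {V : normedModType R}.
Implicit Types (f : V -> R) (x y v : V).

Lemma is_derive_line f y v (t l : R) : is_derive (t *: v + y) v f l ->
  is_derive t 1 (fun h : R => f (h *: v + y)) l.
Proof.
move/is_derive_lineP => d.
have dB : is_derive t 1 (fun h : R => h - t) 1.
  by apply: is_derive_eq (is_deriveB (is_derive_id t 1) (is_derive_cst t t 1)) _; rewrite subr0.
have d' : is_derive (t - t) 1 (fun h : R => f (h *: v + (t *: v + y))) l by rewrite subrr.
have := is_derive_comp dB d'; rewrite mulr1.
rewrite (_ : (fun _ => _) = (fun h : R => f (h *: v + y)))//.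
by apply/funext => h; rewrite addrA -scalerDl subrK.
Qed.

(** Mean value theorem for t |-> f(s t v + y) on [0, 1]; the rescaling treats both signs of [s] at
    once. *)
Lemma line_increment f y v (s d e : R) :
  (forall t, 0 <= t <= 1 -> derivable f ((s * t) *: v + y) v) ->
  (forall t, 0 <= t <= 1 -> `|'D_v f ((s * t) *: v + y) - d| <= e) ->
  `|f (s *: v + y) - f y - s * d| <= e * `|s|.
Proof.
move=> df De.
pose g t := f ((s * t) *: v + y).
have dg (t : R) : 0 <= t <= 1 -> is_derive t 1 g ('D_v f ((s * t) *: v + y) * s).
  move=> t01; have ds : is_derive t 1 (fun h : R => s * h) s.
    apply: is_derive_eq (is_derive_mul (is_derive_cst s t 1) (is_derive_id t 1)) _.
    by rewrite mul0r add0r mulr1.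
  have := is_derive_line (derivableP (df _ t01)) => d1.
  exact: (is_derive_comp ds d1).
have [t||t] := @MVT _ g (fun t => 'D_v f ((s * t) *: v + y) * s) 0 1 ltr01.
- by rewrite in_itv/= => /andP[t0 t1]; apply: dg; rewrite !ltW.
- apply: derivable_within_continuous => t; rewrite in_itv/= => t01.
  by have d1 := dg _ t01; exact: ex_derive.
- rewrite in_itv/= => /andP[t0 t1].
  rewrite /g mulr1 mulr0 scale0r add0r subr0 mulr1 => ->.
  by rewrite [s * d]mulrC -mulrBl normrM ler_wpM2r// De// !ltW.
Qed.

End LineDerivative.

(** * Differentiability from continuous partial derivatives *)

Section Partials.
Context {R : realType} {n : nat}.
Implicit Types (f : 'rV[R]_n -> R) (x v : 'rV[R]_n).
Local Notation e_ i := (basis_vec R i).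

Lemma coord_le_norm v i : `|v 0 i| <= `|v|.
Proof.
rewrite [leRHS]/Num.Def.normr /= mx_normrE; apply/bigmax_geP; right => /=.
by exists (0, i).
Qed.

Lemma norm_le_coord v (M : R) : 0 <= M -> (forall i, `|v 0 i| <= M) -> `|v| <= M.
Proof.
move=> M0 vM; rewrite [leLHS]/Num.Def.normr /= mx_normrE; apply/bigmax_leP; split=> //.
by move=> [i j] _ /=; rewrite (ord1 i).
Qed.

Definition linear_form (c : 'I_n -> R) v : R := \sum_(i < n) v 0 i * c i.

Lemma linear_form_is_linear c : linear (linear_form c).
Proof.
move=> a u v; rewrite /linear_form scaler_sumr -big_split/=.
by apply: eq_bigr => i _; rewrite !mxE mulrDl -mulrA.
Qed.
HB.instance Definition _ c := GRing.isLinear.Build R 'rV[R]_n R _ (linear_form c)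
  (linear_form_is_linear c).

Lemma linear_form_continuous c : continuous (linear_form c).
Proof.
move=> x; apply: (@cvg_bigsum R _ (nbhs x)) => i; apply: cvgM; last exact: cvg_cst.
exact: coord_continuous.
Qed.

Let trunc (h : 'rV[R]_n) (k : nat) : 'rV[R]_n := \row_i (if (i < k)%N then h 0 i else 0).

Let truncS h (i : 'I_n) : trunc h i.+1 = h 0 i *: e_ i + trunc h i.
Proof.
apply/rowP => j; rewrite !mxE eqxx/= ltnS leq_eqVlt.
case: (eqVneq j i) => [->|ji]; first by rewrite eqxx ltnn mulr1 addr0.
by rewrite (_ : (j == i :> nat) = false) ?mulr0 ?add0r//=; apply/negbTE.
Qed.

(** The increment from x to x + h is split into steps along the coordinate axes through the points
    [trunc h k + x]; [line_increment] bounds the error of each step. *)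
Lemma partials_differentiable f x :
  (\forall y \near x, forall i, derivable f y (e_ i)) ->
  (forall i, {for x, continuous ('D_(e_ i) f)}) ->
  differentiable f x.
Proof.
move=> df cDf.
pose L : {linear 'rV[R]_n -> R^o} := linear_form (fun i => 'D_(e_ i) f x).
have fL : (f : 'rV[R]_n -> R^o) \o shift x = cst (f x) + L +o_ (0:'rV[R]_n) id.
  apply/eqaddoP => _/posnumP[e].
  (* The n step errors must add up to at most [e]; dividing by n + 1 also covers n = 0. *)
  have e0 : 0 < e%:num / n.+1%:R by rewrite divr_gt0.
  have [d /= d0 dP] : exists2 d, 0 < d & forall y, `|y - x| < d -> forall i,
     derivable f y (e_ i) /\ `|'D_(e_ i) f y - 'D_(e_ i) f x| <= e%:num / n.+1%:R.
    have : \forall y \near x, forall i,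
       derivable f y (e_ i) /\ `|'D_(e_ i) f y - 'D_(e_ i) f x| <= e%:num / n.+1%:R.
      have H i : \forall y \near x, `|'D_(e_ i) f y - 'D_(e_ i) f x| <= e%:num / n.+1%:R.
        have /cvgrPdist_le/(_ _ e0) := cDf i.
        by apply: filterS => y; rewrite distrC.
      have H' := @filter_forall 'rV[R]_n 'I_n _ (nbhs x) _ H.
      by near=> y; move=> i; split; move: i; near: y; [exact: df|exact: H'].
    move=> /nbhs_ballP[d /= d0 {}H]; exists d => // y yx i.
    by apply: H; rewrite -ball_normE/= distrC.
  near=> h; rewrite /= !fctE/=.
  have hd : `|h| < d by near: h; apply/nbhs_ballP; exists d => //= y; rewrite -ball_normE/= sub0r normrN.
  have step (i : 'I_n) : `|f (trunc h i.+1 + x) - f (trunc h i + x) - h 0 i * 'D_(e_ i) f x|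
     <= e%:num / n.+1%:R * `|h|.
    (* In the sup norm, cancelling some coordinates of [h] and shrinking another one does not
       increase the norm, so every intermediate point stays in the ball. *)
    have inb t : 0 <= t <= 1 -> `|(h 0 i * t) *: e_ i + (trunc h i + x) - x| < d.
      move=> /andP[t0 t1]; apply: le_lt_trans hd; rewrite addrA addrK.
      apply: norm_le_coord => // j; rewrite !mxE eqxx/=.
      have [->|ji] := eqVneq j i.
        rewrite ltnn mulr1 addr0 normrM (le_trans _ (coord_le_norm h i))//.
        by rewrite ler_piMr// ger0_norm.
      rewrite mulr0 add0r; case: ifP => _; last by rewrite normr0.
      exact: coord_le_norm.
    rewrite truncS -[h 0 i *: _ + _ + x]addrA; apply: le_trans (_ : _ <= e%:num / n.+1%:R * `|h 0 i|) _.
      by apply: line_increment => t t01; have [] := dP _ (inb _ t01) i.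
    by rewrite ler_wpM2l ?coord_le_norm// ltW.
  have tele : f (h + x) - (f x + L h) =
      \sum_(i < n) (f (trunc h i.+1 + x) - f (trunc h i + x) - h 0 i * 'D_(e_ i) f x).
    rewrite sumrB opprD addrA; congr (_ - _).
    rewrite -(big_mkord xpredT (fun i => f (trunc h i.+1 + x) - f (trunc h i + x))) telescope_sumr//.
    congr (f _ - f _); last first.
      rewrite (_ : trunc h 0 = 0) ?add0r//.
      by apply/rowP => j; rewrite !mxE ltn0.
    by congr (_ + _); apply/rowP => j; rewrite !mxE ltn_ord.
  rewrite tele; apply: le_trans (ler_norm_sum _ _ _) _.
  apply: le_trans (ler_sum _ (fun i _ => step i)) _.
  rewrite sumr_const card_ord -[leLHS]mulr_natl mulrA ler_wpM2r//.
  rewrite mulrCA ler_piMr// ler_pdivrMr// mul1r ler_nat//.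
have dL : 'd f x = L :> ('rV[R]_n -> R).
  by apply: diff_unique => //; exact: linear_form_continuous.
by apply/diff_locallyP; rewrite dL; split => //; exact: linear_form_continuous.
Unshelve. all: by end_near. Qed.

End Partials.

(** * First- and second-order conditions at a local maximum *)

Section LocalMaximum.
Context {R : realType}.

Lemma cvg_line {V : normedModType R} (x v : V) :
  (fun t : R => t *: v + x) @ (0 : R) --> x.
Proof.
rewrite -[X in _ --> X]add0r -[X in _ --> X + _](scale0r v).
by apply: cvgD; [exact: scalel_continuous|exact: cvg_cst].
Qed.

Lemma near_line {V : normedModType R} (x v : V) (P : set V) :
  (\forall y \near x, P y) -> \forall t \near (0 : R), P (t *: v + x).
Proof. exact: (@cvg_line V x v). Qed.

Lemma derive_local_max (k : R -> R) :
  (\forall t \near (0 : R), derivable k t 1) ->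
  (\forall t \near (0 : R), k t <= k 0) -> 'D_1 k 0 = 0.
Proof.
move=> dk maxk.
have [d /= d0 dP] : exists2 d : R, 0 < d & forall t : R, `|t| < d -> derivable k t 1 /\ k t <= k 0.
  have : \forall t \near (0 : R), derivable k t 1 /\ k t <= k 0.
    by near=> t; split; near: t.
  move=> /nbhs_ballP[d /= d0 H]; exists d => // t td.
  by apply: H; rewrite -ball_normE/= sub0r normrN.
suff d1 : is_derive (0 : R) 1 k 0 by rewrite derive_val.
apply: (@derive1_at_max _ k (- d) d).
- by rewrite ge0_cp// ltW.
- by move=> t; rewrite in_itv/= -ltr_norml => /dP[].
- by rewrite in_itv/= oppr_lt0 d0.
- by move=> t; rewrite in_itv/= -ltr_norml => /dP[].
Unshelve. all: by end_near. Qed.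

(** The first derivative [k1] vanishes at 0. If l > 0, then k1(t)/t > 0 for small t, so [k1] is
    positive just to the right of 0, and the mean value theorem gives a value of [k] above k(0). *)
Lemma derive2_local_max (k k1 : R -> R) (l : R) :
  (\forall t \near (0 : R), is_derive (t : R) 1 k (k1 t)) ->
  is_derive (0 : R) 1 k1 l ->
  (\forall t \near (0 : R), k t <= k 0) -> l <= 0.
Proof.
move=> dk dk1 maxk; rewrite leNgt; apply/negP => l0.
have k10 : k1 0 = 0.
  have d0 := nbhs_singleton dk.
  rewrite -(@derive_val _ _ _ _ _ _ _ d0); apply: derive_local_max => //.
  by move: dk; apply: filterS => t dt; exact: ex_derive.
have [d d0 dP] : exists2 d : R, 0 < d & forall t : R, `|t| < d ->
    [/\ is_derive (t : R) 1 k (k1 t), k t <= k 0 & t != 0 -> 0 < t^-1 * k1 t].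
  have q : h^-1 * k1 h @[h --> (0 : R)^'] --> l.
    have [/= c <-] := dk1; have {}c : (fun h => h^-1 *: ((k1 \o shift 0) (h *: 1) - k1 0)) @ (0 : R)^' --> 'D_1 k1 0 by exact: c.
    apply: cvg_trans c; apply: near_eq_cvg; near=> h.
    by rewrite /= k10 subr0 addr0 [h%:A]mulr1.
  have qpos : \forall h \near (0 : R)^', 0 < h^-1 * k1 h by exact: (cvgr_gt l).
  have : \forall t \near (0 : R), [/\ is_derive (t : R) 1 k (k1 t), k t <= k 0 & t != 0 -> 0 < t^-1 * k1 t].
    have qpos' : \forall t \near (0 : R), t != 0 -> 0 < t^-1 * k1 t by exact: qpos.
    by near=> t; split; near: t.
  move=> /nbhs_ballP[d /= d0 H]; exists d => // t td.
  by apply: H; rewrite -ball_normE/= sub0r normrN.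
have d2 : 0 < d / 2 by rewrite divr_gt0.
have small t : 0 < t <= d / 2 -> `|t| < d.
  by move=> /andP[t0 td]; rewrite gtr0_norm// (le_lt_trans td)// ltr_pdivrMr// ltr_pMr// ltr1n.
have [t||t] := @MVT _ k k1 0 (d / 2) d2.
- rewrite in_itv/= => /andP[t0 td]; have [|//] := dP t; by apply: small; rewrite t0 ltW.
- apply: derivable_within_continuous => t; rewrite in_itv/= => /andP[t0 td].
  have [] := dP t; last by move=> dt _ _; exact: ex_derive.
  by rewrite ger0_norm// (le_lt_trans td)// ltr_pdivrMr// ltr_pMr// ltr1n.
- rewrite in_itv/= => /andP[t0 td] E.
  have [|_ + _] := dP (d / 2); first by apply: small; rewrite d2 lexx.
  have [|_ _] := dP t; first by apply: small; rewrite t0 ltW.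
  rewrite gt_eqF// => /(_ isT); rewrite pmulr_rgt0 ?invr_gt0// => k1t.
  by rewrite -subr_le0 E subr0 leNgt mulr_gt0.
Unshelve. all: by end_near. Qed.

(** As g(x) = 0, the difference quotient of the product is f(x + h v) times that of [g], so
    continuity of [f] at x suffices. *)
Lemma is_derive_mul_vanish {V : normedModType R} (f g : V -> R) (x v : V) (dg : R) :
  {for x, continuous f} -> is_derive x v g dg -> g x = 0 ->
  is_derive x v (fun y => f y * g y) (f x * dg).
Proof.
move=> cf [dgx <-] gx0.
have lim : (fun h : R => h^-1 *: (((fun y => f y * g y) \o shift x) (h *: v) - f x * g x))
    @ (0 : R)^' --> f x * 'D_v g x.
  have c1 : f (h *: v + x) @[h --> (0 : R)^'] --> f x.
    have : (f \o (fun t : R => t *: v + x)) @ (0 : R) --> f x.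
      by exact: (cvg_comp _ _ (@cvg_line V x v) cf).
    exact: cvg_within_filter.
  have c2 : h^-1 *: (g (h *: v + x) - g x) @[h --> (0 : R)^'] --> 'D_v g x by exact: dgx.
  apply: cvg_trans (cvgM c1 c2); apply: near_eq_cvg; near=> h.
  by rewrite /= /GRing.scale/= gx0 mulr0 !subr0 mulrCA.
by apply: DeriveDef; [apply/cvg_ex; exists (f x * 'D_v g x)|exact: cvg_lim].
Unshelve. all: by end_near. Qed.

Section Multivariate.
Context {n : nat}.
Implicit Types (z : 'rV[R]_n -> R) (x v : 'rV[R]_n).
Local Notation e_ i := (basis_vec R i).

Lemma derive_partials z x v : differentiable z x ->
  'D_v z x = \sum_(i < n) v 0 i * 'D_(e_ i) z x.
Proof.
move=> dz; rewrite deriveE// {1}(row_sum_delta v) linear_sum/=.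
by apply: eq_bigr => i _; rewrite linearZ/= deriveE.
Qed.

(** The double sum is the second derivative at 0 of [z] along the line through x in direction v. *)
Lemma hessian_local_max z x v :
  (\forall y \near x, differentiable z y) ->
  (forall i, differentiable ('D_(e_ i) z) x) ->
  (\forall y \near x, z y <= z x) ->
  \sum_(i < n) \sum_(j < n) v 0 i * v 0 j * 'D_(e_ j) ('D_(e_ i) z) x <= 0.
Proof.
move=> dz ddz maxz.
apply: (@derive2_local_max (fun t => z (t *: v + x))
  (fun t => \sum_(i < n) v 0 i * 'D_(e_ i) z (t *: v + x))).
- have := @near_line _ x v (fun y => differentiable z y) dz; apply: filterS => t dzt.
  apply: is_derive_line; rewrite -derive_partials//.
  by apply: derivableP; exact: diff_derivable.
- rewrite (_ : \sum_(i < n) _ = \sum_(i < n) v 0 i * 'D_v ('D_(e_ i) z) x); last first.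
    apply: eq_bigr => i _; rewrite derive_partials// mulr_sumr.
    by apply: eq_bigr => j _; rewrite mulrA.
  rewrite (_ : (fun t => _) =
     \sum_(i < n) (fun t : R => v 0 i * 'D_(e_ i) z (t *: v + x))); last first.
    by apply/funext => t; rewrite fct_sumE.
  apply: is_derive_sum => i.
  have d1 : is_derive ((0 : R) *: v + x) v ('D_(e_ i) z) ('D_v ('D_(e_ i) z) x).
    by rewrite scale0r add0r; apply: derivableP; exact: diff_derivable.
  have d2 := is_derive_mul (is_derive_cst (v 0 i) (0 : R) 1) (is_derive_line d1).
  by apply: is_derive_eq d2 _; rewrite mul0r add0r.
- by rewrite scale0r add0r; exact: (@near_line _ x v (fun y => z y <= z x)).
Qed.

Lemma partial_local_max z x v :
  (\forall y \near x, differentiable z y) ->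
  (\forall y \near x, z y <= z x) -> 'D_v z x = 0.
Proof.
move=> dz maxz.
have dl : \forall t \near (0 : R), derivable (fun s : R => z (s *: v + x)) (t : R) 1.
  have := @near_line _ x v (fun y => differentiable z y) dz; apply: filterS => t dzt.
  have d : is_derive (t *: v + x) v z ('D_v z (t *: v + x)).
    by apply: derivableP; exact: diff_derivable.
  by have d' := is_derive_line d; exact: ex_derive.
have := derive_local_max dl.
rewrite scale0r add0r => /(_ (@near_line _ x v (fun y => z y <= z x) maxz)) <-.
have d : is_derive (0 *: v + x) v z ('D_v z x).
  rewrite scale0r add0r; apply: derivableP; apply: diff_derivable.
  exact: nbhs_singleton dz.
by have d' := is_derive_line d; rewrite derive_val.
Qed.

(** Turns the contraction of a Gram matrix with a Hessian into a sum of values of the Hessian's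
    quadratic form on the rows of [B], each of which has a sign at a maximum. The transposed [H j i]
    gives the order of differentiation of [hessian_local_max]. *)
Lemma gram_contraction (B : 'M[R]_n) (a H : 'I_n -> 'I_n -> R) :
  (forall i j, a i j = \sum_(k < n) B k i * B k j) ->
  \sum_(i < n) \sum_(j < n) a i j * H i j =
  \sum_(k < n) \sum_(i < n) \sum_(j < n) (row k B) 0 i * (row k B) 0 j * H j i.
Proof.
move=> aB; rewrite exchange_big/= [RHS]exchange_big/=; apply: eq_bigr => i _.
rewrite [RHS]exchange_big/=; apply: eq_bigr => j _.
rewrite aB mulr_suml; apply: eq_bigr => k _; rewrite !mxE.
by congr (_ * _); rewrite mulrC.
Qed.

(* The coefficients a only need to be continuous at x since the gradient of z vanishes there. *)
Lemma elliptic_local_max (a : 'I_n -> 'I_n -> 'rV[R]_n -> R) (B : 'M[R]_n) z x :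
  (\forall y \near x, differentiable z y) ->
  (forall i, differentiable ('D_(e_ i) z) x) ->
  (\forall y \near x, z y <= z x) ->
  (forall i j, {for x, continuous (a i j)}) ->
  (forall i j, a i j x = \sum_(k < n) B k i * B k j) ->
  exists d : 'I_n -> R,
    (forall i, is_derive x (e_ i) (fun y => \sum_(j < n) a i j y * 'D_(e_ j) z y) (d i)) /\
    \sum_(i < n) d i <= 0.
Proof.
move=> dz ddz maxz ca aB.
exists (fun i => \sum_(j < n) a i j x * 'D_(e_ i) ('D_(e_ j) z) x); split.
  move=> i; rewrite (_ : (fun y => _) =
     \sum_(j < n) (fun y => a i j y * 'D_(e_ j) z y)); last first.
    by apply/funext => t; rewrite fct_sumE.
  apply: is_derive_sum => j; apply: is_derive_mul_vanish => //.
    by apply: derivableP; exact: diff_derivable.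
  exact: partial_local_max.
rewrite (gram_contraction (fun i j => 'D_(e_ i) ('D_(e_ j) z) x) aB).
by apply: sumr_le0 => k _; exact: hessian_local_max.
Qed.

End Multivariate.
End LocalMaximum.

(** * Polar form of the metric *)

Section DetRankOne.
Context {R : comUnitRingType} {n : nat}.

(** The same block matrix has two block triangular factorisations; compare their determinants. *)
Lemma det_add_rank1 (u : 'cV[R]_n) (v : 'rV[R]_n) :
  \det (1%:M + u *m v) = 1 + (v *m u) 0 0.
Proof.
have E : block_mx (1%:M : 'M[R]_n) (- u) v (1%:M : 'M[R]_1) =
    block_mx (1%:M : 'M[R]_n) 0 v (1%:M : 'M[R]_1) *m block_mx (1%:M : 'M[R]_n) (- u) 0 (1%:M + v *m u).
  rewrite mulmx_block !mulmx0 !mul0mx !mul1mx !mulmx1 !addr0 mulmxN.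
  by rewrite addrCA addNr addr0.
have E' : block_mx (1%:M : 'M[R]_n) (- u) v (1%:M : 'M[R]_1) =
    block_mx (1%:M + u *m v) (- u) 0 (1%:M : 'M[R]_1) *m block_mx (1%:M : 'M[R]_n) 0 v (1%:M : 'M[R]_1).
  rewrite mulmx_block !mulmx0 !mul0mx !mul1mx !mulmx1 !add0r mulNmx.
  by rewrite addrK.
have := congr1 determinant E; rewrite {1}E' !det_mulmx !det_ublock !det_lblock.
rewrite !det1 !mulr1 !mul1r => ->.
by rewrite det_mx11 !mxE eqxx.
Qed.

End DetRankOne.

Section EuclideanNorm.
Context {R : realType} {n : nat}.
Implicit Types x y z : 'rV[R]_n.
Local Notation e_ i := (basis_vec R i).

Lemma dotvE x y : dotv x y = (x *m y^T) 0 0.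
Proof. by rewrite mxE; apply: eq_bigr => i _; rewrite mxE. Qed.

Lemma dotvC x y : dotv x y = dotv y x.
Proof. by apply: eq_bigr => i _; rewrite mulrC. Qed.

Lemma dotvDl x y z : dotv (x + y) z = dotv x z + dotv y z.
Proof. by rewrite -big_split/=; apply: eq_bigr => i _; rewrite mxE mulrDl. Qed.

Lemma dotvZl a x y : dotv (a *: x) y = a * dotv x y.
Proof. by rewrite mulr_sumr; apply: eq_bigr => i _; rewrite mxE mulrA. Qed.

Lemma dotvBl x y z : dotv (x - y) z = dotv x z - dotv y z.
Proof. by rewrite -scaleN1r dotvDl dotvZl mulN1r. Qed.

Lemma dotv_basis x i : dotv x (e_ i) = x 0 i.
Proof.
rewrite /dotv (bigD1 i)//= big1 ?addr0 ?mxE ?eqxx ?mulr1// => j ji.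
by rewrite !mxE (negbTE ji) mulr0.
Qed.

Lemma dotvv_ge0 x : 0 <= dotv x x.
Proof. by apply: sumr_ge0 => i _; rewrite -expr2 sqr_ge0. Qed.

Lemma enorm_ge0 x : 0 <= enorm x.
Proof. exact: sqrtr_ge0. Qed.

Lemma enorm_sqr x : enorm x ^+ 2 = dotv x x.
Proof. by rewrite sqr_sqrtr// dotvv_ge0. Qed.

Lemma enorm0 : enorm (0 : 'rV[R]_n) = 0.
Proof.
by rewrite /enorm /dotv big1 ?sqrtr0// => i _; rewrite mxE mul0r.
Qed.

Lemma coord_le_enorm x i : `|x 0 i| <= enorm x.
Proof.
rewrite -sqrtr_sqr ler_sqrt ?dotvv_ge0// /dotv (bigD1 i)//= -expr2 lerDl.
by apply: sumr_ge0 => j _; rewrite -expr2 sqr_ge0.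
Qed.

Lemma enorm_eq0 x : (enorm x == 0) = (x == 0).
Proof.
apply/eqP/eqP => [x0|->]; last exact: enorm0.
apply/rowP => i; rewrite mxE; apply/eqP; rewrite -normr_le0 -x0.
exact: coord_le_enorm.
Qed.

Lemma enorm_gt0 x : (0 < enorm x) = (x != 0).
Proof. by rewrite lt_def enorm_ge0 andbT enorm_eq0. Qed.

Lemma enormZ a x : enorm (a *: x) = `|a| * enorm x.
Proof.
rewrite /enorm dotvZl dotvC dotvZl mulrA -expr2 sqrtrM ?sqr_ge0//.
by rewrite sqrtr_sqr.
Qed.

Lemma dotv_continuous : continuous (fun x => dotv x x).
Proof.
move=> x; apply: (@cvg_bigsum R _ (nbhs x)) => i.
by apply: cvgM; exact: coord_continuous.
Qed.

Lemma enorm_continuous : continuous (@enorm R n).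
Proof.
move=> x; exact: (@cvg_comp _ _ _ (fun y => dotv y y) Num.sqrt (nbhs x) (nbhs (dotv x x)) (nbhs (Num.sqrt (dotv x x))) (@dotv_continuous x) (@sqrt_continuous R (dotv x x))).
Qed.

Lemma is_derive_coord x v j : is_derive x v (fun y => y 0 j) (v 0 j).
Proof.
apply/is_derive_lineP.
have d := is_derive_mul (is_derive_id (0 : R) 1) (is_derive_cst (v 0 j) (0 : R) 1).
have := is_deriveD d (is_derive_cst (x 0 j) (0 : R) 1).
rewrite mul1r mulr0 !addr0 (_ : _ + _ = (fun h : R => (h *: v + x) 0 j))//.
by apply/funext => h; rewrite fctE !mxE.
Qed.

Lemma is_derive_enorm x i : x != 0 -> is_derive x (e_ i) (@enorm R n) (x 0 i / enorm x).
Proof.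
move=> x0; have ex : 0 < enorm x by rewrite enorm_gt0.
have d1 : is_derive x (e_ i) (fun y => dotv y y) (2 * x 0 i).
  rewrite (_ : (fun y => _) = \sum_(j < n) (fun y : 'rV[R]_n => y 0 j * y 0 j)); last first.
    by apply/funext => y; rewrite fct_sumE.
  have -> : 2 * x 0 i = \sum_(j < n) ((e_ i) 0 j * x 0 j + x 0 j * (e_ i) 0 j).
    rewrite -(dotv_basis x i) mulr_sumr; apply: eq_bigr => j _.
    by rewrite [X in X + _]mulrC -mulr2n mulr_natl.
  by apply: is_derive_sum => j; apply: is_derive_mul; exact: is_derive_coord.
have p0 : 0 < dotv x x by rewrite -enorm_sqr exprn_gt0.
have d2 : is_derive (dotv x x) 1 Num.sqrt (2 * Num.sqrt (dotv x x))^-1.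
  exact: is_derive1_sqrt.
apply: is_derive_eq (is_derive_comp d1 d2) _; rewrite -/(enorm x).
by rewrite invfM mulrACA mulVf ?mul1r 1?mulrC// pnatr_eq0.
Qed.

Lemma geo_ball_open r : open (geo_ball r : set 'rV[R]_n).
Proof.
rewrite (_ : geo_ball r = @enorm R n @^-1` [set y | y < r])//.
by apply: open_comp; [move=> x _; exact: enorm_continuous|exact: open_lt].
Qed.

Lemma geo_cball_compact r : compact (geo_cball r : set 'rV[R]_n).
Proof.
apply: bounded_closed_compact.
  exists r; split; first exact: num_real.
  move=> s rs x /= xr; apply: norm_le_coord.
    by rewrite (le_trans (enorm_ge0 x))// (le_trans xr)// ltW.
  by move=> i; rewrite (le_trans (coord_le_enorm x i))// (le_trans xr)// ltW.
rewrite (_ : geo_cball r = @enorm R n @^-1` [set y | y <= r])//.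
by apply: preimage_closed; [move=> x _; exact: enorm_continuous|exact: closed_le].
Qed.

End EuclideanNorm.

(** * Gram matrices adapted to the radial direction *)

Section RadialMatrix.
Context {R : realType} {n : nat}.
Implicit Types (x y : 'rV[R]_n) (c d : R).
Local Notation e_ i := (basis_vec R i).

(* Gram matrix with eigenvalue 1 in the direction of x and c on its orthogonal
   complement; it is c times the identity at x = 0, by the convention 1 / 0 = 0. *)
Definition radial_mx c x : 'M[R]_n :=
  c%:M + ((1 - c) / enorm x ^+ 2) *: (x^T *m x).

Lemma radial_mxE c x i j :
  radial_mx c x i j = c *+ (i == j) + (1 - c) / enorm x ^+ 2 * (x 0 i * x 0 j).
Proof. by rewrite !mxE big_ord1 !mxE. Qed.

Lemma radial_mx1 x : radial_mx 1 x = 1%:M.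
Proof. by rewrite /radial_mx subrr mul0r scale0r addr0. Qed.

Lemma mulmx_trE x : x *m x^T = (enorm x ^+ 2)%:M.
Proof. by rewrite [LHS]mx11_scalar -dotvE enorm_sqr. Qed.

(** Both matrices are diagonal for the splitting into the line of x and its orthogonal complement,
    so the eigenvalues multiply. This yields the inverse of the metric and a square root of the
    coefficient matrix. *)
Lemma radial_mxM c d x : radial_mx c x *m radial_mx d x = radial_mx (c * d) x.
Proof.
have [->|x0] := eqVneq x 0.
  by rewrite /radial_mx mulmx0 !scaler0 !addr0 scalar_mxM.
have ex : enorm x != 0 by rewrite enorm_eq0.
rewrite /radial_mx mulmxDl !mulmxDr -scalar_mxM -addrA; congr (_ + _).
rewrite mul_scalar_mx mul_mx_scalar -!scalemxAl -!scalemxAr.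
rewrite mulmxA -(mulmxA x^T) mulmx_trE mul_mx_scalar -scalemxAl.
rewrite !scalerA -!scalerDl; congr (_ *: _).
by field.
Qed.

Lemma radial_mx_sym c x i j : radial_mx c x i j = radial_mx c x j i.
Proof. by rewrite !radial_mxE eq_sym [x 0 i * _]mulrC. Qed.

Lemma radial_mx_radial c x i : \sum_(j < n) radial_mx c x i j * x 0 j = x 0 i.
Proof.
have [->|x0] := eqVneq x 0.
  have z k : (0 : 'rV[R]_n) 0 k = 0 by rewrite mxE.
  by rewrite z big1// => j _; rewrite z mulr0.
have ex : enorm x != 0 by rewrite enorm_eq0.
under eq_bigr do rewrite radial_mxE mulrDl -!mulrA.
rewrite big_split/= -!mulr_sumr -/(dotv x x) -enorm_sqr.
rewrite (bigD1 i)//= eqxx big1 => [|j ji]; last first.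
  by rewrite eq_sym (negbTE ji) mulr0n mul0r.
by rewrite mulr1n; field.
Qed.

Lemma radial_mx_det c x : (0 < n)%N -> x != 0 -> c != 0 ->
  \det (radial_mx c x) = c ^+ n.-1.
Proof.
move=> n0 x0 c0; have ex : enorm x != 0 by rewrite enorm_eq0.
have -> : radial_mx c x = c *: (1%:M + (((1 - c) / enorm x ^+ 2 / c) *: x^T) *m x).
  rewrite scalerDr scalemx1 -scalemxAl scalerA; congr (_ + _ *: _).
  by field; rewrite ex c0.
rewrite detZ det_add_rank1 -scalemxAr mxE mulmx_trE mxE eqxx mulr1n.
have -> : c ^+ n = c * c ^+ n.-1 by rewrite -exprS prednK.
by field; rewrite ex c0.
Qed.

End RadialMatrix.

Section SphericallySymmetric.
Context {R : realType} {n : nat}.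
Variables (Rad : R) (f : R -> R) (g : 'rV[R]_n -> 'M[R]_n).
Hypothesis n_gt0 : (0 < n)%N.
Hypothesis f_gt0 : forall t : R, 0 < t <= Rad -> 0 < f t.
Hypothesis g_sym : spherically_symmetric g f Rad.
Implicit Types (x y : 'rV[R]_n) (v : 'rV[R]_n -> R).
Local Notation e_ i := (basis_vec R i).

(** Ratio of Riemannian to Euclidean length for vectors tangent to the sphere of radius t. The value
    1 at 0 is its limit when f'(0) = 1, and makes the formula for the metric valid at p. *)
Definition warping_ratio (t : R) : R := if t == 0 then 1 else f t / t.
Local Notation kap x := (warping_ratio (enorm x)).

Lemma warping_ratio_gt0 (t : R) : 0 <= t <= Rad -> 0 < warping_ratio t.
Proof.
rewrite /warping_ratio => /andP[]; rewrite le_eqVlt eq_sym => /predU1P[->|t0] tR.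
  by rewrite eqxx.
by rewrite gt_eqF// divr_gt0// f_gt0// t0.
Qed.

Lemma metric_mx x : enorm x <= Rad -> g x = radial_mx (kap x ^+ 2) x.
Proof.
move=> xR; have [->|x0] := eqVneq x 0.
  by rewrite enorm0 /warping_ratio eqxx expr1n radial_mx1; case: g_sym.
have t0 : 0 < enorm x by rewrite enorm_gt0.
have tn0 : enorm x != 0 by rewrite gt_eqF.
rewrite /warping_ratio (negbTE tn0); set t := enorm x in xR t0 tn0 *.
(* Each basis vector is split as e_i = al_i th + t xi_i with xi_i orthogonal to th, the form of
   tangent vector on which [spherically_symmetric] evaluates the metric. *)
pose th := t^-1 *: x; pose al i := x 0 i / t.
pose xi i := t^-1 *: (e_ i - al i *: th).
have thth : dotv th th = 1.
  by rewrite dotvZl dotvC dotvZl -enorm_sqr mulrA -invfM -expr2 mulVf// expf_neq0.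
have the i : dotv th (e_ i) = al i by rewrite dotvZl dotv_basis mulrC.
have thxi i : dotv th (xi i) = 0.
  by rewrite dotvC dotvZl dotvBl dotvZl thth mulr1 dotvC the subrr mulr0.
have eth : enorm th = 1 by rewrite enormZ gtr0_norm ?invr_gt0// mulVf.
have eE i : e_ i = al i *: th + t *: xi i.
  by rewrite /xi [t *: _]scalerA mulfV// scale1r addrC subrK.
have xE : x = t *: th by rewrite scalerA mulfV// scale1r.
apply/matrixP => i j.
have [_ /(_ t th (xi i) (xi j) (al i) (al j))] := g_sym.
rewrite t0 xR => /(_ isT eth (thxi i) (thxi j)); rewrite -xE -!eE.
have -> : metric_form g x (e_ i) (e_ j) = g x i j.
  by rewrite /metric_form /basis_vec -rowE trmx_delta -colE !mxE.
have -> : dotv (xi i) (xi j) = t^-1 ^+ 2 * ((i == j)%:R - al i * al j).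
  rewrite dotvZl dotvBl dotvZl thxi mulr0 subr0 dotvC dotvZl dotvBl dotvZl the.
  by rewrite dotv_basis mxE eqxx/= mulrA -expr2 [al j * _]mulrC.
move=> ->; rewrite radial_mxE -/t /al -mulr_natr; field; exact: tn0.
Qed.

Let kap_gt0 x : enorm x <= Rad -> 0 < kap x.
Proof. by move=> xR; apply: warping_ratio_gt0; rewrite enorm_ge0. Qed.

Lemma metric_sqrt_det x : enorm x <= Rad -> Num.sqrt (\det (g x)) = kap x ^+ n.-1.
Proof.
move=> xR; have k0 := kap_gt0 xR; rewrite metric_mx//.
have [->|x0] := eqVneq x 0.
  by rewrite enorm0 /warping_ratio eqxx !expr1n radial_mx1 det1 sqrtr1.
rewrite radial_mx_det// ?expf_neq0 ?gt_eqF// exprAC sqrtr_sqr ger0_norm//.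
by rewrite exprn_ge0// ltW.
Qed.

Lemma metric_inv x : enorm x <= Rad -> invmx (g x) = radial_mx (kap x ^- 2) x.
Proof.
move=> xR; have k0 := kap_gt0 xR; rewrite metric_mx//.
have E : radial_mx (kap x ^- 2) x *m radial_mx (kap x ^+ 2) x = 1%:M.
  by rewrite radial_mxM mulVf ?radial_mx1// expf_neq0// gt_eqF.
have [_ u] := mulmx1_unit E.
by rewrite -[LHS]mul1mx -E mulmxK.
Qed.

(** The coefficients (det g)^(1/2) g^(ij) of the Laplacian in divergence form. *)
Definition symbol i j x : R := kap x ^+ n.-1 * radial_mx (kap x ^- 2) x i j.

Lemma laplace_beltramiE v r x : r <= Rad -> geo_ball r x ->
  laplace_beltrami g v x = (kap x ^+ n.-1)^-1 *
   \sum_(i < n) 'D_(e_ i) (fun y => \sum_(j < n) symbol i j y * 'D_(e_ j) v y) x.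
Proof.
move=> rR xr; have xR : enorm x <= Rad by rewrite (le_trans _ rR)// ltW.
rewrite /laplace_beltrami metric_sqrt_det//; congr (_ * _).
apply: eq_bigr => i _; apply: near_eq_derive.
have : \forall y \near x, geo_ball r y by exact: open_nbhs_nbhs (conj (@geo_ball_open _ _ r) xr).
apply: filterS => y yr; have yR : enorm y <= Rad by rewrite (le_trans _ rR)// ltW.
rewrite metric_sqrt_det// metric_inv// mulr_sumr.
by apply: eq_bigr => j _; rewrite mulrA.
Qed.

(** Ellipticity in explicit form: by [radial_mxM], the square of [radial_mx] with parameter 1/kap is
    the inverse metric, and the scalar factor has a real square root. *)
Lemma symbol_gram x : enorm x <= Rad -> exists B : 'M[R]_n,
  forall i j, symbol i j x = \sum_(k < n) B k i * B k j.
Proof.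
move=> xR; have k0 := kap_gt0 xR.
set s := Num.sqrt (kap x ^+ n.-1); set M := radial_mx (kap x)^-1 x.
have ME k l : (s *: M) k l = s * M k l by rewrite mxE.
exists (s *: M) => i j.
have -> : \sum_(k < n) (s *: M) k i * (s *: M) k j =
   kap x ^+ n.-1 * \sum_(k < n) M i k * M k j.
  rewrite mulr_sumr; apply: eq_bigr => k _; rewrite !ME.
  rewrite mulrACA -expr2 sqr_sqrtr; last by rewrite exprn_ge0// ltW.
  by rewrite /M [radial_mx _ _ k i]radial_mx_sym.
have := congr1 (fun M : 'M[R]_n => M i j) (radial_mxM (kap x)^-1 (kap x)^-1 x).
by rewrite mxE => ->; rewrite -expr2 exprVn.
Qed.

Lemma cvg_enorm_right (h : R -> R) (l : R) :
  h t @[t --> 0^'+] --> l -> h (enorm x) @[x --> (0 : 'rV[R]_n)^'] --> l.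
Proof.
move=> /cvgrPdist_le hl; apply/cvgrPdist_le => e e0.
have [d /= d0 dP] : exists2 d : R, 0 < d & forall t, 0 < t -> t < d -> `|l - h t| <= e.
  have := hl _ e0; rewrite near_withinE => /nbhs_ballP[d /= d0 dP].
  exists d => // t t0 td; apply: dP => //=.
  by rewrite -ball_normE/= sub0r normrN gtr0_norm.
rewrite near_withinE.
have : \forall x \near (0 : 'rV[R]_n), geo_ball d x.
  apply: open_nbhs_nbhs; split; first exact: geo_ball_open.
  by rewrite /geo_ball/= enorm0.
by apply: filterS => x xd x0; apply: dP => //; rewrite enorm_gt0.
Qed.

End SphericallySymmetric.

(** * Radial functions on the ball *)

Section RadialFunctions.
Context {R : realType} {n : nat}.
Variable r : R.
Implicit Types (x y : 'rV[R]_n) (h : R -> R).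
Local Notation e_ i := (basis_vec R i).

Lemma near_geo_ball x : geo_ball r x -> \forall y \near x, geo_ball r y.
Proof. by move=> xr; exact: open_nbhs_nbhs (conj (@geo_ball_open _ _ r) xr). Qed.

Lemma radial_continuous h x : geo_ball r x ->
  (forall t : R, 0 < t < r -> {for t, continuous h}) ->
  h t @[t --> 0^'+] --> h 0 ->
  {for x, continuous (fun y => h (enorm y))}.
Proof.
move=> xr ch h0; have [->|x0] := eqVneq x 0.
  by apply/continuous_withinNx; rewrite enorm0; exact: cvg_enorm_right.
have c : {for enorm x, continuous h} by apply: ch; rewrite enorm_gt0 x0.
exact: (@cvg_comp _ _ _ _ _ (nbhs x) (nbhs (enorm x)) _ (@enorm_continuous _ _ x) c).
Qed.

(* The factor vanishes at x = 0, by the convention 1 / 0 = 0. *)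
Lemma radial_direction_continuous h x i j : geo_ball r x ->
  (forall t : R, 0 < t < r -> {for t, continuous h}) ->
  h t @[t --> 0^'+] --> (0 : R) ->
  {for x, continuous (fun y => h (enorm y) * (y 0 i / enorm y * (y 0 j / enorm y)))}.
Proof.
move=> xr ch h0; have [->|x0] := eqVneq x 0.
  apply/continuous_withinNx; rewrite [(0 : 'rV_n) 0 i]mxE !mul0r mulr0.
  have /cvgr0Pnorm_le hr : h (enorm y) @[y --> (0 : 'rV[R]_n)^'] --> (0 : R).
    exact: cvg_enorm_right.
  apply/cvgr0Pnorm_le => e e0; have := hr _ e0.
  apply: filterS => y; apply: le_trans; rewrite normrM ler_piMr//.
  have q1 k : `|y 0 k / enorm y| <= 1.
    rewrite normrM normfV (ger0_norm (enorm_ge0 y)).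
    have [->|y0] := eqVneq y 0; first by rewrite enorm0 invr0 mulr0.
    by rewrite ler_pdivrMr ?enorm_gt0// mul1r coord_le_enorm.
  by rewrite normrM mulr_ile1.
have ex : enorm x != 0 by rewrite enorm_eq0.
have cd k : {for x, continuous (fun y => y 0 k / enorm y)}.
  apply: continuousM; first exact: coord_continuous.
  by apply: continuousV => //; exact: enorm_continuous.
apply: continuousM; last by apply: continuousM; exact: cd.
have c : {for enorm x, continuous h} by apply: ch; rewrite enorm_gt0 x0.
exact: (@cvg_comp _ _ _ _ _ (nbhs x) (nbhs (enorm x)) _ (@enorm_continuous _ _ x) c).
Qed.

Lemma is_derive_radial h x i (dh : R) : x != 0 -> is_derive (enorm x) 1 h dh ->
  is_derive x (e_ i) (fun y => h (enorm y)) (dh * (x 0 i / enorm x)).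
Proof. by move=> x0 d; exact: is_derive_comp (is_derive_enorm i x0) d. Qed.

Lemma is_derive_radial0 h i : (h t - h 0) / t @[t --> 0^'+] --> (0 : R) ->
  is_derive (0 : 'rV[R]_n) (e_ i) (fun y => h (enorm y)) 0.
Proof.
move=> h0; apply/is_derive_lineP.
have ee : enorm (e_ i) = 1.
  by rewrite /enorm dotv_basis mxE !eqxx sqrtr1.
rewrite (_ : (fun _ => _) = (fun s : R => h `|s|)); last first.
  by apply/funext => s; rewrite addr0 enormZ ee mulr1.
have lim : s^-1 * (h `|s| - h 0) @[s --> (0 : R)^'] --> (0 : R).
  apply/cvgr0Pnorm_le => e e0.
  have /cvgr0Pnorm_le/(_ _ e0) := h0.
  rewrite !near_withinE => /nbhs_ballP[d /= d0 dP].
  apply/nbhs_ballP; exists d => // s /=; rewrite -ball_normE/= sub0r normrN => sd s0.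
  have := dP `|s|; rewrite -ball_normE/= sub0r normrN normr_id normr_gt0.
  by move=> /(_ sd s0); rewrite !normrM !normfV normr_id mulrC.
(* By the convention 1/0 = 0 the quotient takes its limit value 0 at s = 0; multiplied by s it gives
   back h(|s|) - h(0), to which [is_derive_mul_vanish] applies. *)
have c : {for (0 : R), continuous (fun s : R => s^-1 * (h `|s| - h 0))}.
  by apply/continuous_withinNx; rewrite invr0 mul0r.
have d := is_derive_mul_vanish c (is_derive_id (0 : R) 1) erefl.
have := is_deriveD d (is_derive_cst (h 0) (0 : R) 1).
rewrite invr0 !mul0r addr0 (_ : _ + _ = (fun s : R => h `|s|))//.
apply/funext => s; rewrite fctE.
have [->|s0] := eqVneq s 0; first by rewrite mulr0 add0r normr0.
by rewrite mulrAC mulVf// mul1r subrK.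
Qed.

Lemma is_derive_radial_coord0 h i j :
  {for (0 : 'rV[R]_n), continuous (fun y => h (enorm y))} ->
  is_derive (0 : 'rV[R]_n) (e_ j) (fun y => h (enorm y) * y 0 i) (h 0 * (i == j)%:R).
Proof.
move=> ch; have d := is_derive_coord (0 : 'rV[R]_n) (e_ j) i.
have := is_derive_mul_vanish ch d; rewrite enorm0 mxE => /(_ erefl).
by rewrite mxE eqxx.
Qed.

Lemma is_derive_radial_coord h x i j (dh : R) : x != 0 -> is_derive (enorm x) 1 h dh ->
  is_derive x (e_ j) (fun y => h (enorm y) * y 0 i)
    (dh * (x 0 j / enorm x) * x 0 i + h (enorm x) * (i == j)%:R).
Proof.
move=> x0 d; have := is_derive_mul (is_derive_radial j x0 d) (is_derive_coord x (e_ j) i).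
by rewrite [(e_ j) 0 i]mxE eqxx.
Qed.

Lemma radial_within_continuous (u : R -> R) : 0 < r ->
  {within `[0, r], continuous u} ->
  {within geo_cball r, continuous (radial_extension u : 'rV[R]_n -> R)}.
Proof.
move=> r0 /subspace_continuousP cu; apply/subspace_continuousP => x xr.
have xr' : `[0, r]%classic (enorm x) by rewrite /= in_itv/= enorm_ge0.
apply/cvgrPdist_le => e e0.
have /cvgrPdist_le/(_ _ e0) := cu _ xr'; rewrite !near_withinE => H.
have nx : \forall y \near x, `[0, r]%classic (enorm y) -> `|u (enorm x) - u (enorm y)| <= e.
  exact: (@enorm_continuous _ _ x _ H).
near=> y => yr.
have yi : `[0, r]%classic (enorm y) by rewrite /= in_itv/= enorm_ge0.
by move: yi; rewrite /radial_extension; near: y.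
Unshelve. all: by end_near. Qed.

End RadialFunctions.

(** * Regularity and Laplacian of the radial extension of a potential *)

Section RadialSolution.
Context {R : realType} {n : nat}.
Variables (Rad r : R) (f f1 : R -> R) (g : 'rV[R]_n -> 'M[R]_n).
Hypothesis n_gt0 : (0 < n)%N.
Hypothesis r_gt0 : 0 < r.
Hypothesis r_le : r <= Rad.
Hypothesis f0 : f 0 = 0.
Hypothesis cf : {within `[0, r], continuous f}.
Hypothesis f_gt0 : forall t : R, 0 < t <= Rad -> 0 < f t.
Hypothesis df : forall t : R, 0 < t < r -> is_derive t 1 f (f1 t).
Hypothesis cf1 : forall t : R, 0 < t < r -> {for t, continuous f1}.
Hypothesis f1_0 : f1 t @[t --> 0^'+] --> (1 : R).
Hypothesis g_sym : spherically_symmetric g f Rad.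
Implicit Types (x y : 'rV[R]_n).
Local Notation e_ i := (basis_vec R i).
Local Notation N := n.-1.
Local Notation kap := (warping_ratio f).

Let f_gt0' (t : R) : 0 < t <= r -> 0 < f t.
Proof. by move=> /andP[t0 tr]; apply: f_gt0; rewrite t0 (le_trans tr). Qed.

Let ratio_cvg : f t / t @[t --> 0^'+] --> (1 : R) := warping_ratio_cvg1 r_gt0 f0 cf df f1_0.

Let kap_cvg : kap t @[t --> 0^'+] --> (1 : R).
Proof.
apply: cvg_trans ratio_cvg; apply: near_eq_cvg; near=> t.
by rewrite /warping_ratio gt_eqF.
Unshelve. all: by end_near. Qed.

Let kap0 : kap 0 = 1. Proof. by rewrite /warping_ratio eqxx. Qed.

Let near_pos (t : R) : 0 < t < r -> \forall s \near t, 0 < s < r.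
Proof.
by move=> /andP[t0 tr]; near=> s; apply/andP; split; near: s; [exact: lt_nbhsr|exact: lt_nbhsl].
Unshelve. all: by end_near. Qed.

Let cf_in (t : R) : 0 < t < r -> {for t, continuous f}.
Proof. by move=> tr; exact: within_continuous_at tr cf. Qed.

Let kap_continuous (t : R) : 0 < t < r -> {for t, continuous kap}.
Proof.
move=> /[dup] tr /andP[t0 _].
have c : {for t, continuous (fun s => f s / s)}.
  apply: continuousM; first exact: cf_in.
  by apply: continuousV; [rewrite gt_eqF|].
have E : {near t, (fun s => f s / s) =1 kap}.
  by have := near_pos tr; apply: filterS => s /andP[s0 _]; rewrite /warping_ratio gt_eqF.
exact: near_eq_continuous E c.
Qed.

Let kap_gt0 (t : R) : 0 <= t <= r -> 0 < kap t.
Proof.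
by move=> /andP[t0 tr]; apply: (warping_ratio_gt0 f_gt0); rewrite t0 (le_trans tr).
Qed.

(** The only term that depends on the direction at the centre is x_i x_j / |x|^2; it is bounded, and
    its factor 1 - kap^(-2) tends to 0 because f(t)/t tends to 1. *)
Lemma symbol_continuous x i j : geo_ball r x -> {for x, continuous (symbol f i j)}.
Proof.
move=> xr.
have cX k : {for x, continuous (fun y => kap (enorm y) ^+ k)}.
  apply: (radial_continuous xr (h := fun t => kap t ^+ k)).
    by move=> t tr; apply: cvgXn; exact: kap_continuous.
  by rewrite kap0; exact: cvgXn.
have cV : {for x, continuous (fun y => kap (enorm y) ^- 2)}.
  apply: continuousV; last exact: cX.
  by rewrite expf_neq0// gt_eqF// kap_gt0// enorm_ge0 ltW.
have cD : {for x, continuous (fun y => (1 - kap (enorm y) ^- 2) *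
    (y 0 i / enorm y * (y 0 j / enorm y)))}.
  apply: (radial_direction_continuous (h := fun t => 1 - kap t ^- 2) xr).
    move=> t /[dup] tr /andP[t0 tr']; apply: continuousB; first exact: cvg_cst.
    apply: continuousV; first by rewrite expf_neq0// gt_eqF// kap_gt0// !ltW.
    by apply: cvgXn; exact: kap_continuous.
  have : 1 - kap t ^- 2 @[t --> 0^'+] --> (1 - (1 ^+ 2)^-1 : R).
    apply: cvgB; first exact: cvg_cst.
    apply: cvgV; first by rewrite expf_neq0 ?oner_neq0.
    exact: cvgXn kap_cvg.
  by rewrite expr1n invr1 subrr.
rewrite (_ : symbol f i j = (fun y => kap (enorm y) ^+ N *
   (kap (enorm y) ^- 2 * (i == j)%:R + (1 - kap (enorm y) ^- 2) *
    (y 0 i / enorm y * (y 0 j / enorm y))))); last first.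
  apply/funext => y; rewrite /symbol radial_mxE.
  congr (_ * (_ + _)); first by rewrite mulr_natr.
  by rewrite -mulrA; congr (_ * _); rewrite [RHS]mulrACA -invfM -expr2 mulrC.
apply: continuousM; first exact: cX.
apply: continuousD; last exact: cD.
by apply: continuousM; [exact: cV|exact: cst_continuous].
Qed.

Section Solution.
Variables (q w : R -> R) (c : R).
Hypothesis cq : {within `[0, r], continuous q}.
Hypothesis wE : forall t : R, 0 <= t <= r -> w t = c - radial_potential N f q t.
Local Notation P := (radial_slope N f q).
Local Notation W := (radial_potential N f q).
Local Notation wt := (radial_extension w : 'rV[R]_n -> R).

Let cP : {within `[0, r], continuous P}.
Proof. exact: (@slope_continuous _ _ _ _ f1). Qed.

Let P0 : P 0 = 0. Proof. exact: (@slope0 _ _ r). Qed.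

Let dP (t : R) : 0 < t < r -> is_derive t 1 P (q t - N%:R * f1 t / f t * P t).
Proof. by move=> tr; exact: slope_derive. Qed.

Let W_prim : primitive_on r P W.
Proof. exact: (@potential_primitive _ _ _ _ f1). Qed.

(** Q = W'/t, so the gradient of [wt] at x is -Q(|x|) x, a formula that remains valid at the
    centre. *)
Let Q (t : R) : R := if t == 0 then q 0 / n%:R else P t / t.

Let nE : N.+1 = n. Proof. exact: prednK. Qed.

Let Q_cvg : Q t @[t --> 0^'+] --> Q 0.
Proof.
have := @slope_quotient_cvg _ N r f f1 r_gt0 f0 cf f_gt0' df f1_0 q cq.
rewrite nE {2}/Q eqxx; apply: cvg_trans; apply: near_eq_cvg; near=> t.
by rewrite /Q gt_eqF.
Unshelve. all: by end_near. Qed.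

(** S = W'' - W'/t = t Q'. The Hessian of [wt] is minus the sum of S x_i x_j / |x|^2 and Q times the
    identity, so its continuity at the centre amounts to S -> 0. *)
Let S (t : R) : R := if t == 0 then 0 else q t - N%:R * f1 t / f t * P t - Q t.

Let dQ (t : R) : 0 < t < r -> is_derive t 1 Q (S t / t).
Proof.
move=> /[dup] tr /andP[t0 _]; have tn0 : t != 0 by rewrite gt_eqF.
have d := is_derive_mul (dP tr) (@is_derive_inv _ _ id t 1 _ tn0 (is_derive_id t 1)).
have E : {near t, (fun s => P s / s) =1 Q}.
  by have := near_pos tr; apply: filterS => s /andP[s0 _]; rewrite /Q gt_eqF.
apply: near_eq_is_derive E _; apply: is_derive_eq d _.
rewrite /S /Q (negbTE tn0) /=; set D := q t - _; field; exact: tn0.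
Qed.

Let Q_continuous (t : R) : 0 < t < r -> {for t, continuous Q}.
Proof.
move=> tr; apply: differentiable_continuous; apply/derivable1_diffP.
by have d := dQ tr; exact: ex_derive.
Qed.

Let S_continuous (t : R) : 0 < t < r -> {for t, continuous S}.
Proof.
move=> /[dup] tr /andP[t0 trr].
have c1 : {for t, continuous (fun t => q t - N%:R * f1 t / f t * P t - Q t)}.
  apply: continuousB; last exact: Q_continuous.
  apply: continuousB; first exact: within_continuous_at tr cq.
  apply: continuousM; last exact: within_continuous_at tr cP.
  apply: continuousM; last first.
    by apply: continuousV; [rewrite gt_eqF// f_gt0'// t0 ltW|exact: cf_in].
  by apply: continuousM; [exact: cvg_cst|exact: cf1].
have E : {near t, (fun t => q t - N%:R * f1 t / f t * P t - Q t) =1 S}.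
  by have := near_pos tr; apply: filterS => s /andP[s0 _]; rewrite /S gt_eqF.
exact: near_eq_continuous E c1.
Qed.

(** Since W'/f = Q/kap, the limit is q(0) - (N + 1) Q(0), which is 0 because Q(0) = q(0)/n and n = N
    + 1. *)
Let S_cvg : S t @[t --> 0^'+] --> (0 : R).
Proof.
have : q t - N%:R * f1 t * (kap t)^-1 * Q t - Q t @[t --> 0^'+] -->
   q 0 - N%:R * 1 * 1^-1 * Q 0 - Q 0.
  apply: cvgB; last exact: Q_cvg.
  apply: cvgB; first by move: cq; rewrite continuous_within_itvP// => -[].
  apply: cvgM; last exact: Q_cvg.
  apply: cvgM; last by apply: cvgV; [exact: oner_neq0|exact: kap_cvg].
  by apply: cvgM; [exact: cvg_cst|exact: f1_0].
have -> : q 0 - N%:R * 1 * 1^-1 * Q 0 - Q 0 = 0.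
  have n0 : n%:R != 0 :> R by rewrite pnatr_eq0 -lt0n.
  rewrite /Q eqxx -[n in n%:R]nE in n0 *; rewrite -natr1 in n0 *; field; exact: n0.
apply: cvg_trans; apply: near_eq_cvg; near=> t.
have t0 : 0 < t by [].
have ft0 : f t != 0 by rewrite gt_eqF// f_gt0'// t0 ltW.
rewrite /S /Q /warping_ratio gt_eqF//; field; rewrite ft0 gt_eqF//.
Unshelve. all: by end_near. Qed.

Let near_w x : geo_ball r x -> \forall y \near x, wt y = c - W (enorm y).
Proof.
move=> xr; have := near_geo_ball xr; apply: filterS => y yr.
by rewrite /radial_extension wE// enorm_ge0 ltW.
Qed.

Let dw x i : geo_ball r x -> is_derive x (e_ i) wt (- (Q (enorm x) * x 0 i)).
Proof.
move=> xr; have [W0 cW dW] := W_prim.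
have d : is_derive x (e_ i) (fun y => W (enorm y)) (Q (enorm x) * x 0 i).
  have [->|x0] := eqVneq x 0.
    rewrite mxE mulr0; apply: is_derive_radial0; rewrite W0.
    rewrite (_ : (fun t => _) = (fun t => W t / t)); last by apply/funext => t; rewrite subr0.
    apply: (@lhopital_at_right _ W P id (fun=> 1) 0 r) => //.
    + by rewrite -{2}W0; move: cW; rewrite continuous_within_itvP// => -[].
    + exact: (@cvg_at_right_filter _ _ id).
    + under eq_cvg do rewrite divr1.
      have : P t @[t --> 0^'+] --> P 0 by move: cP; rewrite continuous_within_itvP// => -[].
      by rewrite P0.
  have ex : 0 < enorm x by rewrite enorm_gt0.
  have xr' : 0 < enorm x < r by rewrite ex.
  apply: is_derive_eq (is_derive_radial i x0 (dW _ xr')) _.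
  by rewrite /Q gt_eqF// mulrA mulrAC.
have d' := is_deriveB (is_derive_cst c x (e_ i)) d; rewrite sub0r in d'.
apply: near_eq_is_derive d'.
by have := near_w xr; apply: filterS => y ->; rewrite fctE.
Qed.

Let cQ x : geo_ball r x -> {for x, continuous (fun y => Q (enorm y))}.
Proof.
by move=> xr; apply: (radial_continuous xr); [exact: Q_continuous|exact: Q_cvg].
Qed.

Let H i j x := - (S (enorm x) * (x 0 i / enorm x * (x 0 j / enorm x)) + Q (enorm x) * (i == j)%:R).

Let near_dw x i : geo_ball r x ->
  \forall y \near x, - (Q (enorm y) * y 0 i) = 'D_(e_ i) wt y.
Proof.
move=> xr; have := near_geo_ball xr; apply: filterS => y yr.
by have d := dw i yr; rewrite derive_val.
Qed.

Let ddw x i j : geo_ball r x -> is_derive x (e_ j) ('D_(e_ i) wt) (H i j x).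
Proof.
move=> xr; have E := near_dw i xr; apply: near_eq_is_derive E _.
apply: is_deriveN; have [->|x0] := eqVneq x 0.
  have z k : (0 : 'rV[R]_n) 0 k = 0 by rewrite mxE.
  rewrite !z !mul0r mulr0 add0r enorm0; apply: is_derive_radial_coord0.
  by apply: cQ; rewrite /geo_ball/= enorm0.
have ex : 0 < enorm x by rewrite enorm_gt0.
have xr' : 0 < enorm x < r by rewrite ex.
apply: is_derive_eq (is_derive_radial_coord i j x0 (dQ xr')) _.
congr (_ + _); field; exact: lt0r_neq0.
Qed.

Lemma radial_solution_C2 : C2_open (geo_ball r) wt.
Proof.
move=> x xr; have cx i : {for x, continuous ('D_(e_ i) wt)}.
  have c1 : {for x, continuous (fun y => - (Q (enorm y) * y 0 i))}.
    by apply: continuousN; apply: continuousM; [exact: cQ|exact: coord_continuous].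
  exact: near_eq_continuous (near_dw i xr) c1.
have near1 i : \forall y \near x, derivable wt y (e_ i).
  have := near_geo_ball xr; apply: filterS => y yr.
  by have d := dw i yr; exact: ex_derive.
split.
  apply: differentiable_continuous; apply: partials_differentiable => //.
  exact: (@filter_forall _ _ _ (nbhs x)).
move=> i; split; first by exact: nbhs_singleton (near1 i).
split=> // j; split; first by have d := ddw i j xr; exact: ex_derive.
have c2 : {for x, continuous (H i j)}.
  apply: continuousN; apply: continuousD.
    apply: (radial_direction_continuous xr); [exact: S_continuous|exact: S_cvg].
  by apply: continuousM; [exact: cQ|exact: cst_continuous].
have E : \forall y \near x, H i j y = 'D_(e_ j) ('D_(e_ i) wt) y.
  have := near_geo_ball xr; apply: filterS => y yr.
  by have d := ddw i j yr; rewrite derive_val.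
exact: near_eq_continuous E c2.
Qed.

(** The vector field whose divergence is taken in the Laplacian of [wt] is -F(|x|) x, because x is
    an eigenvector of the inverse metric with eigenvalue 1. *)
Let F (t : R) := kap t ^+ N * Q t.

Let F_flux (t : R) : 0 < t < r -> F t = radial_flux N f q t / t ^+ n.
Proof.
move=> /andP[t0 tr]; have tn0 : t != 0 by rewrite gt_eqF.
have ft0 : f t != 0 by rewrite gt_eqF// f_gt0'// t0 ltW.
rewrite /F /Q /kap (negbTE tn0) /radial_slope expr_div_n -[n in RHS]nE exprS.
by field; rewrite tn0 !expf_neq0.
Qed.

Let dF (t : R) : 0 < t < r ->
  is_derive t 1 F ((kap t ^+ N * q t - n%:R * F t) / t).
Proof.
move=> /[dup] tr /andP[t0 trr]; have tn0 : t != 0 by rewrite gt_eqF.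
have ft0 : f t != 0 by rewrite gt_eqF// f_gt0'// t0 ltW.
have [_ _ /(_ _ tr) dfl] := @flux_primitive _ N r f r_gt0 cf q cq.
have tN0 : t ^+ n != 0 by rewrite expf_neq0.
have d := is_derive_mul dfl (@is_derive_inv R R (fun s : R => s ^+ n) t 1 _ tN0
  (@is_derive_exp R R id n t 1 _ (is_derive_id t 1))).
have E : {near t, (fun s => radial_flux N f q s / s ^+ n) =1 F}.
  by have := near_pos tr; apply: filterS => s sr; rewrite F_flux.
apply: near_eq_is_derive E _; apply: is_derive_eq d _.
have tE : t ^+ n = t * t ^+ N by rewrite -exprS nE.
rewrite F_flux// /warping_ratio (negbTE tn0) expr_div_n tE /=.
by field; rewrite tn0 !expf_neq0.
Qed.

(** The divergence of F(|x|) x is t F' + n F = kap^N q by [dF], and n F(0) = q(0) at the centre. The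
    partial derivatives are exhibited one by one so that they can be combined with those of another
    field in the comparison argument. *)
Lemma radial_solution_flux x : geo_ball r x -> exists d : 'I_n -> R,
  (forall i, is_derive x (e_ i) (fun y => \sum_(j < n) symbol f i j y * 'D_(e_ j) wt y) (d i)) /\
  \sum_(i < n) d i = - (kap (enorm x) ^+ N * q (enorm x)).
Proof.
move=> xr.
have near_sum i : \forall y \near x, - (F (enorm y) * y 0 i) =
    \sum_(j < n) symbol f i j y * 'D_(e_ j) wt y.
  have := near_geo_ball xr; apply: filterS => y yr.
  have -> : \sum_(j < n) symbol f i j y * 'D_(e_ j) wt y =
     \sum_(j < n) (- F (enorm y)) * (radial_mx (kap (enorm y) ^- 2) y i j * y 0 j).
    apply: eq_bigr => j _; have d := dw j yr; rewrite derive_val /symbol /F.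
    ring.
  by rewrite -mulr_sumr radial_mx_radial mulNr.
have [x0|x0] := eqVneq x 0; last first.
  have ex : 0 < enorm x by rewrite enorm_gt0.
  have xr' : 0 < enorm x < r by rewrite ex.
  have en0 : enorm x != 0 by rewrite gt_eqF.
  pose dF' := (kap (enorm x) ^+ N * q (enorm x) - n%:R * F (enorm x)) / enorm x.
  exists (fun i => - (dF' * (x 0 i / enorm x) * x 0 i + F (enorm x) * (i == i)%:R)); split.
    move=> i; apply: near_eq_is_derive (near_sum i) _; apply: is_deriveN.
    exact: is_derive_radial_coord (dF xr').
  rewrite sumrN; congr (- _); rewrite big_split/=.
  under [X in _ + X]eq_bigr do rewrite eqxx mulr1.
  rewrite sumr_const card_ord -mulr_natl.
  have -> : \sum_(i < n) dF' * (x 0 i / enorm x) * x 0 i = dF' / enorm x * dotv x x.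
    by rewrite mulr_sumr; apply: eq_bigr => i _; field.
  by rewrite -enorm_sqr /dF'; field.
exists (fun i => - (F 0 * (i == i)%:R)); split.
  move=> i; apply: near_eq_is_derive (near_sum i) _; apply: is_deriveN.
  rewrite x0; apply: is_derive_radial_coord0; rewrite -x0.
  apply: (radial_continuous xr).
    by move=> t tr; apply: differentiable_continuous; apply/derivable1_diffP;
      have d := dF tr; exact: ex_derive.
  by apply: cvgM; [rewrite kap0; exact: cvgXn|exact: Q_cvg].
under eq_bigr do rewrite eqxx mulr1.
rewrite sumr_const card_ord x0 enorm0 /F kap0 expr1n !mul1r /Q eqxx -[LHS]mulr_natr.
by rewrite mulNr divfK// pnatr_eq0 -lt0n.
Qed.

Lemma radial_solution_laplace x : geo_ball r x ->
  laplace_beltrami g wt x = - q (enorm x).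
Proof.
move=> xr; rewrite (laplace_beltramiE n_gt0 f_gt0 g_sym wt r_le xr).
have [d [dd sd]] := radial_solution_flux xr.
under eq_bigr do rewrite (@derive_val _ _ _ _ _ _ _ (dd _)).
rewrite sd mulrN mulKf// expf_neq0// gt_eqF// kap_gt0// enorm_ge0 ltW//.
Qed.

End Solution.
End RadialSolution.

(** * Comparison with a positive radial solution *)

Lemma near_eq_differentiable {R : realType} {V W : normedModType R} (f h : V -> W) (x : V) :
  (\forall y \near x, f y = h y) -> differentiable f x -> differentiable h x.
Proof.
move=> fh dfx; have fhx : f x = h x := nbhs_singleton fh.
have cd : continuous ('d f x) by exact: diff_continuous.
have E : h \o shift x = cst (h x) + 'd f x +o_ (0 : V) id.
  apply/eqaddoP => _/posnumP[e].
  have /eqaddoP/(_ e%:num) := diff_locally dfx; rewrite -fhx => /(_ _)/wrap[//|].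
  have sh : \forall y \near (0 : V), f (y + x) = h (y + x).
    have c : (fun y : V => y + x) @ (0 : V) --> x.
      by rewrite -[X in _ --> X]add0r; apply: cvgD; [exact: cvg_id|exact: cvg_cst].
    exact: (c _ fh).
  move=> H; near=> y; have : f (y + x) = h (y + x) by near: y.
  rewrite /= !fctE => <-; near: y; exact: H.
have dE : 'd h x = 'd f x :> (V -> W) by exact: diff_unique.
by apply/diff_locallyP; rewrite dE.
Unshelve. all: by end_near. Qed.

Section C2Differentiable.
Context {R : realType} {n : nat}.
Local Notation e_ i := (basis_vec R i).

Lemma C2_open_differentiable (r : R) (v : 'rV[R]_n -> R) x :
  C2_open (geo_ball r) v -> geo_ball r x ->
  differentiable v x /\ forall i, differentiable ('D_(e_ i) v) x.
Proof.
move=> vC2 xr; have nb := near_geo_ball xr.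
split=> [|i]; apply: partials_differentiable.
- by apply: filterS nb => y yr i; have [_ /(_ i)[]] := vC2 _ yr.
- by move=> i; have [_ /(_ i)[_ []]] := vC2 _ xr.
- by apply: filterS nb => y yr j; have [_ /(_ i)[_ [_ /(_ j)[]]]] := vC2 _ yr.
- by move=> j; have [_ /(_ i)[_ [_ /(_ j)[]]]] := vC2 _ xr.
Qed.

End C2Differentiable.

Section Comparison.
Context {R : realType} {n : nat}.
Variables (Rad r : R) (f f1 : R -> R) (g : 'rV[R]_n -> 'M[R]_n).
Hypothesis n_gt0 : (0 < n)%N.
Hypothesis r_gt0 : 0 < r.
Hypothesis r_le : r <= Rad.
Hypothesis f0 : f 0 = 0.
Hypothesis cf : {within `[0, r], continuous f}.
Hypothesis f_gt0 : forall t : R, 0 < t <= Rad -> 0 < f t.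
Hypothesis df : forall t : R, 0 < t < r -> is_derive t 1 f (f1 t).
Hypothesis cf1 : forall t : R, 0 < t < r -> {for t, continuous f1}.
Hypothesis f1_0 : f1 t @[t --> 0^'+] --> (1 : R).
Hypothesis g_sym : spherically_symmetric g f Rad.
Implicit Types (x y : 'rV[R]_n).
Local Notation e_ i := (basis_vec R i).
Local Notation kap := (warping_ratio f).

(* The quotient of v by the positive supersolution p has an interior extremum,
   where the equation for v is compared with that for p. *)
Lemma positive_supersolution_bound (v : 'rV[R]_n -> R) (p : R -> R) (c nu lambda : R) :
  {within `[0, r], continuous p} ->
  (forall t : R, 0 <= t <= r -> p t = c - radial_potential n.-1 f (fun s => nu * p s) t) ->
  (forall t : R, 0 <= t <= r -> 0 < p t) ->
  dirichlet_eigenfunction g r lambda v -> nu <= lambda.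
Proof.
move=> cp pE p_gt0 [vC2 cv [x1 x1r vx1] v_eq v_bd].
have cq : {within `[0, r], continuous (fun s => nu * p s)}.
  by move=> t; apply: cvgM; [exact: cvg_cst|exact: cp].
pose pt : 'rV[R]_n -> R := radial_extension p.
have pt_gt0 x : geo_cball r x -> 0 < pt x.
  by move=> xr; apply: p_gt0; rewrite enorm_ge0.
have cpt : {within geo_cball r, continuous pt} by exact: radial_within_continuous.
(* The sign makes s v positive at [x1], so the maximum [c0] of s v / pt is positive and cannot be
   attained on the sphere, where v vanishes. *)
pose s := Num.sg (v x1).
have ss : s * s = 1 by rewrite -expr2 sqr_sg vx1.
have [x0] : exists2 x, x \in geo_cball r &
    forall y, y \in geo_cball r -> s * v y / pt y <= s * v x / pt x.
  apply: (@compact_EVT_max _ R (fun x => s * v x / pt x)); first by exists x1.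
    exact: geo_cball_compact.
  rewrite continuous_subspace_in => x xr; apply: cvgM.
    by apply: cvgM; [exact: cvg_cst|exact: cv].
  by apply: cvgV; [rewrite gt_eqF// pt_gt0//; rewrite inE in xr|exact: cpt].
rewrite inE => x0r max0.
set c0 := s * v x0 / pt x0 in max0.
have c0_gt0 : 0 < c0.
  apply: lt_le_trans (max0 x1 _); last by rewrite inE.
  by rewrite divr_gt0 ?pt_gt0// /s -normrEsg normr_gt0.
have c0E : s * v x0 = c0 * pt x0 by rewrite divfK// gt_eqF// pt_gt0.
have x0b : geo_ball r x0.
  move: x0r; rewrite /geo_cball/geo_ball/= le_eqVlt => /predU1P[x0s|//].
  by move: c0_gt0; rewrite /c0 v_bd// mulr0 mul0r ltxx.
have ptC2 : C2_open (geo_ball r) pt.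
  exact: (@radial_solution_C2 _ _ Rad r f f1 _ _ _ _ _ _ _ _ _ (fun s => nu * p s) p c).
(* A maximum of the quotient becomes a local maximum of this difference, with value 0. *)
pose z y := s * v y - c0 * pt y.
have dvp y : geo_ball r y -> differentiable v y /\ differentiable pt y.
  by move=> yr; split; [have [] := C2_open_differentiable vC2 yr|have [] := C2_open_differentiable ptC2 yr].
have dz y : geo_ball r y -> differentiable z y.
  move=> yr; have [dv dp] := dvp _ yr.
  by apply: differentiableB; apply: differentiableZ.
have Dz y i : geo_ball r y -> 'D_(e_ i) z y = s * 'D_(e_ i) v y - c0 * 'D_(e_ i) pt y.
  move=> yr; have [dv dp] := dvp _ yr.
  have d1 : is_derive y (e_ i) v ('D_(e_ i) v y) by apply: derivableP; exact: diff_derivable.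
  have d2 : is_derive y (e_ i) pt ('D_(e_ i) pt y) by apply: derivableP; exact: diff_derivable.
  by have d3 := is_deriveB (is_deriveZ s d1) (is_deriveZ c0 d2); rewrite derive_val.
have nb := near_geo_ball x0b.
have near_dz : \forall y \near x0, differentiable z y by apply: filterS nb.
have ddz i : differentiable ('D_(e_ i) z) x0.
  have [_ /(_ i) d1] := C2_open_differentiable vC2 x0b.
  have [_ /(_ i) d2] := C2_open_differentiable ptC2 x0b.
  apply: (@near_eq_differentiable _ _ _ (s *: 'D_(e_ i) v - c0 *: 'D_(e_ i) pt)).
    by apply: filterS nb => y yr; rewrite Dz.
  by apply: differentiableB; apply: differentiableZ.
have maxz : \forall y \near x0, z y <= z x0.
  apply: filterS nb => y yr; rewrite /z c0E subrr subr_le0.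
  have yr' : geo_cball r y by exact: ltW.
  by rewrite -ler_pdivrMr ?pt_gt0// max0// inE.
have x0R : enorm x0 <= Rad by rewrite (le_trans _ r_le).
have [B BE] := symbol_gram f_gt0 x0R.
have ca i j : {for x0, continuous (symbol f i j)}.
  exact: (@symbol_continuous _ _ Rad r f f1).
have [d1 [d1E d1_le0]] := elliptic_local_max near_dz ddz maxz ca BE.
have [d2 [d2E d2s]] : exists d : 'I_n -> R,
  (forall i, is_derive x0 (e_ i) (fun y => \sum_(j < n) symbol f i j y * 'D_(e_ j) pt y) (d i)) /\
  \sum_(i < n) d i = - (kap (enorm x0) ^+ n.-1 * (nu * p (enorm x0))).
  exact: (radial_solution_flux n_gt0 r_gt0 r_le f0 cf f_gt0 df f1_0 cq pE x0b).
(* Regularity C^2 of v does not by itself make its flux derivable where the coefficients are only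
   continuous. Derivability at [x0] comes from v = s (z + c0 pt), both of whose terms have been
   treated. *)
have dv i : is_derive x0 (e_ i) (fun y => \sum_(j < n) symbol f i j y * 'D_(e_ j) v y)
    (s * (d1 i + c0 * d2 i)).
  have d3 := is_deriveZ s (is_deriveD (d1E i) (is_deriveZ c0 (d2E i))).
  apply: near_eq_is_derive d3.
  apply: filterS nb => y yr; rewrite !fctE.
  transitivity (s * (\sum_(j < n) symbol f i j y * 'D_(e_ j) z y +
     c0 * \sum_(j < n) symbol f i j y * 'D_(e_ j) pt y)); first by [].
  rewrite (mulr_sumr _ _ _ c0) -big_split/= mulr_sumr.
  apply: eq_bigr => j _; rewrite Dz//.
  by transitivity (s * s * (symbol f i j y * 'D_(e_ j) v y)); [ring|rewrite ss mul1r].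
have k_gt0 : 0 < kap (enorm x0) ^+ n.-1.
  by rewrite exprn_gt0// (warping_ratio_gt0 f_gt0)// enorm_ge0.
have := v_eq _ x0b; rewrite (laplace_beltramiE n_gt0 f_gt0 g_sym v r_le x0b).
under eq_bigr do rewrite (@derive_val _ _ _ _ _ _ _ (dv _)).
rewrite -mulr_sumr big_split/= -mulr_sumr d2s => /eqP; rewrite addr_eq0 => /eqP E.
have svp : 0 < s * v x0 by rewrite c0E mulr_gt0// pt_gt0.
(* As s v = c0 pt at [x0], the equation for v compares -lambda and -nu on the same positive value;
   they differ by the Laplacian of z, which is at most 0. *)
have {}E : - lambda * (s * v x0) = (kap (enorm x0) ^+ n.-1)^-1 * \sum_(i < n) d1 i - nu * (s * v x0).
  rewrite mulrCA mulNr -E c0E.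
  transitivity ((kap (enorm x0) ^+ n.-1)^-1 * (s * s) *
     (\sum_(i < n) d1 i + c0 * - (kap (enorm x0) ^+ n.-1 * (nu * p (enorm x0))))); first by ring.
  by rewrite ss mulr1 /pt /radial_extension; field; exact: lt0r_neq0.
have : (kap (enorm x0) ^+ n.-1)^-1 * \sum_(i < n) d1 i <= 0.
  by rewrite mulr_ge0_le0// invr_ge0 ltW.
by move=> d1'; rewrite -(ler_pM2r svp); move: E d1'; rewrite mulNr; lra.
Qed.

End Comparison.

(** * Radial solutions as power series in the spectral parameter *)

Section DominatedSeries.
Context {R : realType}.
Implicit Types u v : R^nat.

Lemma cvg_le_norm u v (a b : R) :
  u @ \oo --> a -> v @ \oo --> b -> (forall m, `|u m| <= v m) -> `|a| <= b.
Proof.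
move=> ua vb uv; apply: (ler_cvg_to (cvg_norm ua) vb).
by near=> m; exact: uv.
Unshelve. all: by end_near. Qed.

Lemma dominated_series_cvg u v : (forall k, `|u k| <= v k) ->
  cvgn (series v) -> cvgn (series u).
Proof.
move=> uv cv; apply: normed_cvg.
apply: (@series_le_cvg _ (fun k => `|u k|) v) => // k; exact: le_trans (normr_ge0 _) (uv k).
Qed.

Lemma dominated_series_tail u v m : (forall k, `|u k| <= v k) ->
  cvgn (series v) -> `|limn (series u) - series u m| <= limn (series v) - series v m.
Proof.
move=> uv cv; have cu := dominated_series_cvg uv cv.
apply: (ler_cvg_to (cvg_norm (cvgB cu (cvg_cst (series u m)))) (cvgB cv (cvg_cst (series v m)))).
near=> j; have mj : (m <= j)%N by near: j; exact: nbhs_infty_ge.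
rewrite !fctE !sub_series_geq//; apply: le_trans (ler_norm_sum _ _ _) _.
by apply: ler_sum => k _; exact: uv.
Unshelve. all: by end_near. Qed.

End DominatedSeries.

Section RadialEigenSeries.
Context {R : realType}.
Variables (N : nat) (r : R) (f f1 : R -> R).
Hypothesis r_gt0 : 0 < r.
Hypothesis f0 : f 0 = 0.
Hypothesis cf : {within `[0, r], continuous f}.
Hypothesis f_gt0 : forall t : R, 0 < t <= r -> 0 < f t.
Hypothesis df : forall t : R, 0 < t < r -> is_derive t 1 f (f1 t).
Hypothesis f1_0 : f1 t @[t --> 0^'+] --> (1 : R).
Local Notation flux := (radial_flux N f).
Local Notation slope := (radial_slope N f).
Local Notation potential := (radial_potential N f).
Implicit Types q : R -> R.

Let flux_prim q (cq : {within `[0, r], continuous q}) := flux_primitive N r_gt0 cf cq.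
Let pot_prim q (cq : {within `[0, r], continuous q}) :
  primitive_on r (slope q) (potential q).
Proof. exact: (@potential_primitive _ _ _ _ f1). Qed.

(** [f] may fail to be monotone, but f(t) = kap(t) t with kap between two positive bounds, so f(s)
    exceeds f(t) for s <= t by at most the ratio of these bounds. *)
Lemma power_warping_quasi_monotone : exists2 C : R, 0 < C &
  forall s t : R, 0 < s -> s <= t -> t <= r -> f s ^+ N <= C * f t ^+ N.
Proof.
have ck : {within `[0, r], continuous (warping_ratio f)}.
  have n_at (t : R) : 0 < t -> \forall s \near t, f s / s = warping_ratio f s.
    move=> t0; have : \forall s \near t, 0 < s by exact: lt_nbhsr.
    by apply: filterS => s s0; rewrite /warping_ratio gt_eqF.
  move: cf; rewrite !continuous_within_itvP// => -[ci _ cr]; split.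
  - move=> t tr; have := tr; rewrite in_itv/= => /andP[t0 _].
    apply: (near_eq_continuous (n_at t t0)).
    by apply: continuousM; [exact: ci|apply: continuousV; [rewrite gt_eqF|]].
  - rewrite {2}/warping_ratio eqxx.
    apply: cvg_trans (warping_ratio_cvg1 r_gt0 f0 cf df f1_0).
    by apply: near_eq_cvg; near=> t; rewrite /warping_ratio gt_eqF.
  - have -> : warping_ratio f r = f r / r by rewrite /warping_ratio gt_eqF.
    have : f t / t @[t --> r^'-] --> f r / r.
      apply: cvgM => //; apply: cvgV; first by rewrite gt_eqF.
      exact: (@cvg_at_left_filter _ _ id).
    apply: cvg_trans; apply: near_eq_cvg; near=> t; rewrite /warping_ratio gt_eqF//.
have k_gt0 t : 0 <= t <= r -> 0 < warping_ratio f t by exact: warping_ratio_gt0.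
have [a ar amin] := EVT_min (ltW r_gt0) ck.
have [b br bmax] := EVT_max (ltW r_gt0) ck.
have a0 : 0 < warping_ratio f a by apply: k_gt0; rewrite in_itv in ar.
have b0 : 0 < warping_ratio f b by apply: k_gt0; rewrite in_itv in br.
have fE t : 0 < t -> f t = warping_ratio f t * t.
  by move=> t0; rewrite /warping_ratio gt_eqF// divfK// gt_eqF.
exists ((warping_ratio f b / warping_ratio f a) ^+ N).
  by rewrite exprn_gt0// divr_gt0.
move=> s t s0 st tr; have t0 : 0 < t by exact: lt_le_trans st.
rewrite -exprMn; apply: lerXn2r; rewrite ?nnegrE.
- by rewrite ltW// f_gt0// s0 (le_trans st).
- by rewrite mulr_ge0// ltW ?divr_gt0// f_gt0// t0.
rewrite (fE s)// (fE t)//.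
apply: le_trans (_ : _ <= warping_ratio f b * t) _.
  apply: ler_pM => //; [by rewrite ltW// k_gt0// ltW//= (le_trans st)|by rewrite ltW|].
  by apply: bmax; rewrite in_itv/= ltW//= (le_trans st).
rewrite mulrA ler_pM2r// mulrAC ler_pdivlMr// ler_pM2l//.
by apply: amin; rewrite in_itv/= ltW.
Unshelve. all: by end_near. Qed.

Section Bounds.
Variable C : R.
Hypothesis C_gt0 : 0 < C.
Hypothesis CP : forall s t : R, 0 < s -> s <= t -> t <= r -> f s ^+ N <= C * f t ^+ N.

(** By the mean value theorem the flux at t is t f(s)^N q(s) for some s < t; quasi-monotonicity then
    absorbs the division by f(t)^N. *)
Lemma slope_bound q (B t : R) : {within `[0, r], continuous q} -> 0 < t <= r ->
  (forall s, 0 <= s <= t -> `|q s| <= B) -> `|slope q t| <= C * t * B.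
Proof.
move=> cq /andP[t0 tr] qB; have [F0 cF dF] := flux_prim cq.
have ft0 : 0 < f t ^+ N by rewrite exprn_gt0// f_gt0// t0.
rewrite /slope normrM normfV (gtr0_norm ft0) ler_pdivrMr//.
have [s||s] := @MVT _ (flux q) (fun s => f s ^+ N * q s) 0 t t0.
- rewrite in_itv/= => /andP[s0 st]; apply: dF.
  by rewrite s0 (lt_le_trans st).
- by apply: within_continuous_subitv cF.
rewrite in_itv/= => /andP[s0 st]; rewrite F0 !subr0 => ->.
rewrite !normrM (gtr0_norm t0) (_ : C * t * B * _ = C * f t ^+ N * B * t); last by ring.
rewrite ler_pM2r//; apply: ler_pM => //.
  by rewrite ger0_norm ?CP ?exprn_ge0// ltW// f_gt0// s0 ltW// (lt_le_trans st).
by apply: qB; rewrite !ltW.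
Qed.

(** G + potential and G - potential have non-negative derivatives, and G(0) >= 0. *)
Lemma potential_bound q (b G : R -> R) : {within `[0, r], continuous q} ->
  {within `[0, r], continuous G} -> 0 <= G 0 ->
  (forall t, 0 < t < r -> is_derive t 1 G (b t)) ->
  (forall t, 0 < t < r -> `|slope q t| <= b t) ->
  forall t, 0 <= t <= r -> `|potential q t| <= G t.
Proof.
move=> cq cG G0 dG qb t /andP[t0 tr]; have [W0 cW dW] := pot_prim cq.
have sub s : 0 < s < t -> 0 < s < r by move=> /andP[-> /lt_le_trans->].
rewrite ler_norml -subr_ge0 opprK; apply/andP; split.
- apply: le_trans (_ : _ <= potential q 0 + G 0) _; first by rewrite W0 add0r.
  apply: (@deriv_ge0_le _ 0 t (potential q + G) (fun s => slope q s + b s)) => //.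
  + by apply: within_continuous_subitv (within_continuousD cW cG).
  + by move=> s /sub sr; have := dW _ sr; have := dG _ sr => *; exact: is_deriveD.
  + by move=> s /sub /qb; rewrite ler_norml -subr_ge0 opprK => /andP[].
- rewrite -subr_ge0; apply: le_trans (_ : _ <= G 0 - potential q 0) _; first by rewrite W0 subr0.
  apply: (@deriv_ge0_le _ 0 t (G - potential q) (fun s => b s - slope q s)) => //.
  + by apply: within_continuous_subitv (within_continuousB cG cW).
  + by move=> s /sub sr; have := dW _ sr; have := dG _ sr => *; exact: is_deriveB.
  + by move=> s /sub /qb; rewrite ler_norml subr_ge0 => /andP[].
Qed.

Lemma potential_sup_bound q (B t : R) : {within `[0, r], continuous q} -> 0 <= t <= r ->
  (forall s, 0 <= s <= r -> `|q s| <= B) -> `|potential q t| <= C * r * B * r.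
Proof.
move=> cq tr qB; have B0 : 0 <= B.
  by apply: le_trans (qB 0 _); rewrite // lexx ltW.
have CrB : 0 <= C * r * B by rewrite !mulr_ge0// ltW.
have tr' := tr; case/andP: tr' => t0 tr'.
apply: le_trans (_ : _ <= C * r * B * t) _; last by rewrite ler_wpM2l.
apply: (potential_bound (b := fun=> C * r * B) (G := fun t => C * r * B * t)) => //.
- by apply: continuous_subspaceT; exact: mulrl_continuous.
- by rewrite mulr0.
- move=> s _; apply: is_derive_eq (is_derive_mul (is_derive_cst (C * r * B) s 1) (is_derive_id s 1)) _.
  by rewrite mul0r add0r mulr1.
- move=> s /andP[s0 sr]; apply: le_trans (slope_bound (B := B) cq _ _) _.
  + by rewrite s0 ltW.
  + by move=> x /andP[x0 xs]; rewrite qB// x0 (le_trans xs)// ltW.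
  + by rewrite ler_wpM2r// ler_wpM2l// ltW.
Qed.

End Bounds.

Lemma potential_linear (a : R) q1 q2 (t : R) :
  {within `[0, r], continuous q1} -> {within `[0, r], continuous q2} -> 0 <= t <= r ->
  potential (fun s => a * q1 s + q2 s) t = a * potential q1 t + potential q2 t.
Proof.
move=> c1 c2 tr.
have lin G1 G2 F1 F2 : primitive_on r G1 F1 -> primitive_on r G2 F2 ->
    primitive_on r (fun s => a * G1 s + G2 s) (fun s => a * F1 s + F2 s).
  move=> [F10 cF1 dF1] [F20 cF2 dF2]; split.
  - by rewrite F10 F20 mulr0 addr0.
  - by move=> s; apply: cvgD; [apply: cvgM; [exact: cvg_cst|exact: cF1]|exact: cF2].
  - move=> s sr; have d1 := is_derive_mul (is_derive_cst a s 1) (dF1 _ sr).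
    by apply: is_derive_eq (is_deriveD d1 (dF2 _ sr)) _; rewrite mul0r add0r.
have c3 : {within `[0, r], continuous (fun s => a * q1 s + q2 s)}.
  by move=> s; apply: cvgD; [apply: cvgM; [exact: cvg_cst|exact: c1]|exact: c2].
have flin s : 0 <= s <= r ->
    flux (fun s => a * q1 s + q2 s) s = a * flux q1 s + flux q2 s.
  have := lin _ _ _ _ (flux_prim c1) (flux_prim c2).
  rewrite (_ : (fun s => _ + _) = (fun s => f s ^+ N * (a * q1 s + q2 s))); last first.
    by apply/funext => x; ring.
  by move=> pf sr; rewrite (primitive_unique (flux_prim c3) pf sr).
apply: (primitive_unique (F2 := fun s => a * potential q1 s + potential q2 s) (pot_prim c3) _ tr).
have [W0 cW dW] := lin _ _ _ _ (pot_prim c1) (pot_prim c2); split => //.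
move=> s sr; apply: is_derive_eq (dW s sr) _.
rewrite /slope flin; last by case/andP: sr => /ltW-> /ltW->.
by rewrite mulrDl mulrA.
Qed.

Lemma potentialZ (a : R) q (t : R) : {within `[0, r], continuous q} -> 0 <= t <= r ->
  potential (fun s => a * q s) t = a * potential q t.
Proof.
move=> cq tr; have := potential_linear (a - 1) cq cq tr.
rewrite (_ : (fun s => _ + _) = (fun s => a * q s)) => [->|]; first by ring.
by apply/funext => s; ring.
Qed.

End RadialEigenSeries.

(** * Series solution of the radial eigenvalue equation *)

Section RadialEigenfunction.
Context {R : realType}.
Variables (N : nat) (r : R) (f f1 : R -> R).
Hypothesis r_gt0 : 0 < r.
Hypothesis f0 : f 0 = 0.
Hypothesis cf : {within `[0, r], continuous f}.
Hypothesis f_gt0 : forall t : R, 0 < t <= r -> 0 < f t.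
Hypothesis df : forall t : R, 0 < t < r -> is_derive t 1 f (f1 t).
Hypothesis f1_0 : f1 t @[t --> 0^'+] --> (1 : R).
Local Notation slope := (radial_slope N f).
Local Notation potential := (radial_potential N f).
Variable C : R.
Hypothesis C_gt0 : 0 < C.
Hypothesis CP : forall s t : R, 0 < s -> s <= t -> t <= r -> f s ^+ N <= C * f t ^+ N.
Implicit Types q : R -> R.

Let pot_prim q (cq : {within `[0, r], continuous q}) :
  primitive_on r (slope q) (potential q).
Proof. exact: (@potential_primitive _ _ _ _ f1). Qed.
Let pot_cont q (cq : {within `[0, r], continuous q}) : {within `[0, r], continuous (potential q)}.
Proof. by have [] := pot_prim cq. Qed.

(** Upper bound of the factor C t of [slope_bound] on [0, r]: each application of [potential] costs
    at most K and one integration. *)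
Let K := C * r.
Let K_gt0 : 0 < K. Proof. by rewrite mulr_gt0. Qed.

(** Iterating phi = 1 - mu potential(phi) from the constant 1 gives phi as the sum of (-mu)^k p_k,
    where p_k is the k-th iterated potential of 1. *)
Definition radial_coef (k : nat) : R -> R := iter k potential (fun=> 1).
Local Notation p := radial_coef.

Lemma radial_coef_continuous k : {within `[0, r], continuous (p k)}.
Proof.
elim: k => [|k IH]; last exact: pot_cont.
by apply: continuous_subspaceT => t; exact: cst_continuous.
Qed.

(** Induction: the bound (K s)^k / k! is nondecreasing in s, so it also bounds p_k on all of [0, s];
    [slope_bound] and one integration raise k by one. *)
Lemma radial_coef_bound k (t : R) : 0 <= t <= r -> `|p k t| <= exp_coeff (K * t) k.
Proof.
elim: k t => [|k IH] t tr.
  by rewrite /exp_coeff /= expr0 normr1 divr1.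
pose G (s : R) := exp_coeff (K * s) k.+1.
have dG (s : R) : is_derive s 1 G (K * exp_coeff (K * s) k).
  have d1 := is_derive_mul (is_derive_cst K s 1) (is_derive_id s 1).
  have d2 := is_derive_mul (is_derive_exp k.+1 d1) (is_derive_cst (k.+1`!%:R^-1 : R) s 1).
  apply: is_derive_eq d2 _; rewrite /exp_coeff /= mulr0 addr0 mul0r add0r mulr1.
  rewrite factS natrM; field.
  by rewrite nat1r !pnatr_eq0 -!lt0n fact_gt0.
apply: (potential_bound r_gt0 f0 cf f_gt0 df f1_0 (b := fun s => K * exp_coeff (K * s) k) (G := G)) => //.
- exact: radial_coef_continuous.
- apply: derivable_within_continuous => s _.
  by have d := dG s; exact: ex_derive.
- by rewrite /G mulr0 /exp_coeff /= expr0n /= mul0r.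
- move=> s /andP[s0 sr].
  have sr' : 0 < s <= r by rewrite s0 ltW.
  have e0 : 0 <= exp_coeff (K * s) k by rewrite exp_coeff_ge0// mulr_ge0// ltW.
  have sb : `|slope (p k) s| <= C * s * exp_coeff (K * s) k.
    apply: (slope_bound r_gt0 cf f_gt0 CP (@radial_coef_continuous k) sr').
    move=> x /andP[x0 xs]; apply: le_trans (IH x _) _.
      by rewrite x0 (le_trans xs)// ltW.
    rewrite /exp_coeff /= ler_pM2r ?invr_gt0 ?ltr0n ?fact_gt0//.
    by rewrite lerXn2r ?nnegrE ?mulr_ge0 ?ler_wpM2l// ?ltW.
  by apply: le_trans sb _; rewrite ler_wpM2r// ler_wpM2l// ltW.
Qed.

Section FixedParameter.
Variable mu : R.
Let L := `|mu| * (K * r).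
Let term (t : R) (k : nat) : R := (- mu) ^+ k * p k t.
Let S (m : nat) (t : R) : R := series (term t) m.

Definition radial_solution (t : R) : R := limn (series (fun k => (- mu) ^+ k * p k t)).
Local Notation phi := radial_solution.

Lemma radial_term_bound k (t : R) : 0 <= t <= r ->
  `|(- mu) ^+ k * p k t| <= exp_coeff (`|mu| * (K * r)) k.
Proof.
move=> tr; rewrite normrM normrX normrN.
apply: le_trans (_ : _ <= `|mu| ^+ k * exp_coeff (K * r) k) _; last first.
  by rewrite /exp_coeff /= [(`|mu| * _) ^+ k]exprMn mulrA.
rewrite ler_wpM2l ?exprn_ge0//; apply: le_trans (radial_coef_bound k tr) _.
case/andP: tr => t0 tr.
rewrite /exp_coeff /= ler_pM2r ?invr_gt0 ?ltr0n ?fact_gt0//.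
by rewrite lerXn2r ?nnegrE ?mulr_ge0 ?ler_wpM2l// ?ltW.
Qed.

(** Tail of the exponential majorant, a bound uniform in t for the distance from the partial sum to
    the limit. *)
Let eps m := expR L - series (exp_coeff L) m.

Let eps_cvg0 : eps @ \oo --> 0.
Proof.
rewrite -(subrr (expR L)); apply: cvgB; first exact: cvg_cst.
exact: is_cvg_series_exp_coeff.
Qed.

Let phi_tail m (t : R) : 0 <= t <= r -> `|phi t - S m t| <= eps m.
Proof.
move=> tr; apply: dominated_series_tail; last exact: is_cvg_series_exp_coeff.
by move=> k; exact: radial_term_bound.
Qed.

Let SS m t : S m.+1 t = S m t + (- mu) ^+ m * p m t.
Proof. by rewrite /S seriesSr. Qed.

Let S_continuous m : {within `[0, r], continuous (S m)}.
Proof.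
elim: m => [|m IH].
  rewrite (_ : S 0 = fun=> 0); last by apply/funext => t; rewrite /S /series /= big_geq.
  by apply: continuous_subspaceT => t; exact: cst_continuous.
rewrite (_ : S m.+1 = fun t => S m t + (- mu) ^+ m * p m t); last by apply/funext => t; rewrite SS.
move=> t; apply: cvgD; first exact: IH.
by apply: cvgM; [exact: cvg_cst|exact: radial_coef_continuous].
Qed.

Lemma radial_solution_continuous : {within `[0, r], continuous phi}.
Proof.
apply/subspace_continuousP => x xr; apply/cvgrPdist_le => e e0.
have e3 : 0 < e / 3 by rewrite divr_gt0.
have [m mP] : exists m, eps m <= e / 3.
  have /cvgr0Pnorm_le/(_ _ e3) := eps_cvg0.
  move=> [m _ /(_ m (leqnn m))]; exists m.
  exact: le_trans (ler_norm _) _.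
have /subspace_continuousP/(_ x xr)/cvgrPdist_le/(_ _ e3) := @S_continuous m.
rewrite !near_withinE; apply: filterS => y /[swap] yr /(_ yr) H.
have := le_trans (phi_tail m (t := x) _) mP; have := le_trans (phi_tail m (t := y) _) mP.
move: xr yr; rewrite /= !in_itv/= => xr yr /(_ yr) hy /(_ xr) hx.
rewrite (_ : phi x - phi y = (phi x - S m x) + (S m x - S m y) - (phi y - S m y)); last by ring.
apply: le_trans (ler_normB _ _) _; apply: le_trans (lerD (ler_normD _ _) (lexx _)) _.
lra.
Qed.

Let scal_continuous (q : R -> R) (a : R) : {within `[0, r], continuous q} ->
  {within `[0, r], continuous (fun s => a * q s)}.
Proof. by move=> cq t; apply: cvgM; [exact: cvg_cst|exact: cq]. Qed.

Let pot_lin (a : R) q1 q2 (t : R) : {within `[0, r], continuous q1} ->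
  {within `[0, r], continuous q2} -> 0 <= t <= r ->
  potential (fun s => a * q1 s + q2 s) t = a * potential q1 t + potential q2 t.
Proof. move=> c1 c2 tr; exact: (potential_linear N r_gt0 f0 cf f_gt0 df f1_0 a c1 c2 tr). Qed.

Let S_rec m (t : R) : 0 <= t <= r -> S m.+1 t = 1 - potential (fun s => mu * S m s) t.
Proof.
move=> tr; elim: m => [|m IH].
  rewrite SS expr0 mul1r /S /series /= big_geq// add0r.
  rewrite (_ : (fun s => _) = (fun s => (-1) * (fun=> 0) s + (fun=> 0) s)); last first.
    by apply/funext => s; rewrite big_geq// !mulr0 addr0.
  have c0 : {within `[0, r], continuous (fun=> 0 : R)}.
    by apply: continuous_subspaceT => s; exact: cst_continuous.
  by rewrite pot_lin// mulN1r addNr subr0.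
rewrite SS IH.
rewrite (_ : (fun s => mu * S m.+1 s) =
   (fun s => (mu * (- mu) ^+ m) * p m s + mu * S m s)); last first.
  by apply/funext => s; rewrite SS; ring.
rewrite pot_lin//; [|exact: radial_coef_continuous|exact: scal_continuous].
have -> : p m.+1 t = potential (p m) t by [].
move: (potential (p m) t) (potential _ t) => x y.
by rewrite exprS; ring.
Qed.

(** [S_rec] is the same equation for partial sums with the index shifted by one. Its error in the
    limit is bounded by two multiples of [eps], since [potential] is bounded in the sup norm, so the
    defect [X] is dominated by a sequence tending to 0. *)
Lemma radial_solution_eq (t : R) : 0 <= t <= r ->
  phi t = 1 - potential (fun s => mu * phi s) t.
Proof.
move=> tr; apply/eqP; rewrite -subr_eq0 -normr_le0.
set X := phi t - _.
have bd m : `|X| <= eps m.+1 + K * (`|mu| * eps m) * r.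
  have -> : X = (phi t - S m.+1 t) +
      potential (fun s => (-1) * (mu * S m s) + mu * phi s) t.
    rewrite /X pot_lin//.
    - rewrite S_rec//; move: (phi t) (potential (fun s => mu * phi s) t) (potential _ t) => x y z.
      by ring.
    - by apply: scal_continuous; exact: S_continuous.
    - by apply: scal_continuous; exact: radial_solution_continuous.
  apply: le_trans (ler_normD _ _) _; apply: lerD; first exact: phi_tail.
  apply: (potential_sup_bound r_gt0 f0 cf f_gt0 df f1_0 C_gt0 CP) => //.
    have cS : {within `[0, r], continuous (fun s => (-1) * (mu * S m s))}.
      by apply: scal_continuous; apply: scal_continuous; exact: S_continuous.
    have cp : {within `[0, r], continuous (fun s => mu * phi s)}.
      by apply: scal_continuous; exact: radial_solution_continuous.
    by move=> s; apply: cvgD; [exact: cS|exact: cp].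
  move=> s sr; rewrite mulN1r addrC -mulrBr normrM ler_wpM2l//.
  exact: phi_tail.
have lim : (fun m => eps m.+1 + K * (`|mu| * eps m) * r) @ \oo --> 0 + K * (`|mu| * 0) * r.
  apply: cvgD; first by have := eps_cvg0; rewrite -cvg_shiftS.
  by apply: cvgMl; apply: cvgMr; apply: cvgMr; exact: eps_cvg0.
rewrite !mulr0 mul0r addr0 in lim.
exact: (cvg_le_norm (cvg_cst X) lim bd).
Qed.

End FixedParameter.

(** For 0 <= nu <= mu each mu^k - nu^k is non-negative, so the termwise bounds add up to a
    difference of exponentials, independent of t. *)
Lemma radial_solution_modulus (mu nu t : R) : 0 <= nu -> nu <= mu -> 0 <= t <= r ->
  `|radial_solution mu t - radial_solution nu t| <= expR (mu * (K * r)) - expR (nu * (K * r)).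
Proof.
move=> nu0 numu tr; have mu0 : 0 <= mu by exact: le_trans numu.
have cE x := is_cvg_series_exp_coeff (x : R).
have cphi x : cvgn (series (fun k => (- x) ^+ k * p k t)).
  by apply: (dominated_series_cvg (v := exp_coeff (`|x| * (K * r)))) => // k; exact: radial_term_bound.
apply: (cvg_le_norm (cvgB (cphi mu) (cphi nu)) (cvgB (cE (mu * (K * r))) (cE (nu * (K * r))))) => m.
rewrite !fctE /series /= -!sumrB; apply: le_trans (ler_norm_sum _ _ _) _.
apply: ler_sum => k _; rewrite -mulrBl normrM.
have -> : `|(- mu) ^+ k - (- nu) ^+ k| = mu ^+ k - nu ^+ k.
  rewrite [(- mu) ^+ k]exprNn [(- nu) ^+ k]exprNn -mulrBr normrM normrX normrN1 expr1n mul1r.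
  by rewrite ger0_norm// subr_ge0 lerXn2r.
have -> : exp_coeff (mu * (K * r)) k - exp_coeff (nu * (K * r)) k =
    (mu ^+ k - nu ^+ k) * exp_coeff (K * r) k.
  by rewrite /exp_coeff /= !exprMn; ring.
rewrite ler_wpM2l ?subr_ge0 ?lerXn2r//; apply: le_trans (radial_coef_bound k tr) _.
case/andP: tr => t0 tr.
rewrite /exp_coeff /= ler_pM2r ?invr_gt0 ?ltr0n ?fact_gt0//.
by rewrite lerXn2r ?nnegrE ?mulr_ge0 ?ler_wpM2l// ?ltW.
Qed.

Lemma radial_solution_param0 (t : R) : radial_solution 0 t = 1.
Proof.
apply: cvg_lim => //; apply: cvg_near_cst; near=> m.
have [k ->] : exists k, m = k.+1.
  by exists m.-1; rewrite prednK//; near: m; exact: nbhs_infty_gt.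
rewrite /series /= big_nat_recl// expr0 mul1r big1 ?addr0// => j _.
by rewrite oppr0 expr0n /= mul0r.
Unshelve. all: by end_near. Qed.

Lemma radial_solution0 (mu : R) : radial_solution mu 0 = 1.
Proof.
have z : 0 <= (0 : R) <= r by rewrite lexx ltW.
rewrite radial_solution_eq//.
have cmu : {within `[0, r], continuous (fun s => mu * radial_solution mu s)}.
  by move=> t; apply: cvgM; [exact: cvg_cst|exact: radial_solution_continuous].
by have [-> _ _] := pot_prim cmu; rewrite subr0.
Qed.

End RadialEigenfunction.

(** * Barta's inequalities *)

Section RadialBarta.
Context {R : realType}.
Variables (N : nat) (r : R) (f f1 : R -> R).
Hypothesis r_gt0 : 0 < r.
Hypothesis f0 : f 0 = 0.
Hypothesis cf : {within `[0, r], continuous f}.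
Hypothesis f_gt0 : forall t : R, 0 < t <= r -> 0 < f t.
Hypothesis df : forall t : R, 0 < t < r -> is_derive t 1 f (f1 t).
Hypothesis f1_0 : f1 t @[t --> 0^'+] --> (1 : R).
Local Notation flux := (radial_flux N f).
Local Notation slope := (radial_slope N f).
Local Notation potential := (radial_potential N f).
Local Notation mu := (@lebesgue_measure R).
Implicit Types q : R -> R.

Let flux_prim q (cq : {within `[0, r], continuous q}) := flux_primitive N r_gt0 cf cq.
Let pot_prim q (cq : {within `[0, r], continuous q}) :
  primitive_on r (slope q) (potential q).
Proof. exact: (@potential_primitive _ _ _ _ f1). Qed.

Let fN_gt0 (t : R) : 0 < t <= r -> 0 < f t ^+ N.
Proof. by move=> tr; rewrite exprn_gt0// f_gt0. Qed.

Lemma flux_ge0 q (t : R) : {within `[0, r], continuous q} ->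
  (forall s, 0 <= s <= r -> 0 <= q s) -> 0 <= t <= r -> 0 <= flux q t.
Proof.
move=> cq q0 /andP[t0 tr]; have [F0 cF dF] := flux_prim cq.
rewrite -F0; apply: (deriv_ge0_le (G := fun s => f s ^+ N * q s) t0).
- exact: within_continuous_subitv cF.
- by move=> s /andP[s0 st]; apply: dF; rewrite s0 (lt_le_trans st).
- move=> s /andP[s0 st]; rewrite mulr_ge0//.
    by rewrite ltW// fN_gt0// s0 ltW// (lt_le_trans st).
  by rewrite q0// ltW//= ltW// (lt_le_trans st).
Qed.

(** Otherwise the potential is constant on [t, r] and the flux vanishes at points of ]t, r[
    arbitrarily close to r; a zero flux from 0 to such a point forces q = 0 before it. *)
Lemma potential_lt q (t : R) : {within `[0, r], continuous q} ->
  (forall s, 0 <= s <= r -> 0 <= q s) -> (exists2 s, 0 <= s <= r & q s != 0) ->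
  0 <= t < r -> potential q t < potential q r.
Proof.
move=> cq q0 [s0 s0r qs0] /andP[t0 tr]; rewrite ltNge; apply/negP => Wrt.
have [F0 cF dF] := flux_prim cq; have [W0 cW dW] := pot_prim cq.
have slope_ge0 s : 0 < s < r -> 0 <= slope q s.
  move=> /andP[s1 s2]; rewrite divr_ge0//; last by rewrite ltW// fN_gt0// s1 ltW.
  by apply: flux_ge0; rewrite // !ltW.
have z s : t < s < r -> slope q s = 0.
  apply: (deriv_ge0_eq0 (ltW tr) (F := potential q)) => //.
  - exact: within_continuous_subitv cW.
  - by move=> x /andP[tx xr]; apply: dW; rewrite (le_lt_trans t0).
  - by move=> x /andP[tx xr]; apply: slope_ge0; rewrite (le_lt_trans t0).
have qz s : 0 < s < r -> q s = 0.
  (* The point y is taken beyond t, where the slope vanishes, and beyond s, so that s lies in the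
     range of the flux at y. *)
  move=> /andP[s1 s2]; pose x := Num.max s t.
  have x_r : x < r by rewrite gt_max s2.
  have [y /andP[xy yr]] : exists y, x < y < r.
    by exists ((x + r) / 2); rewrite !midf_lt.
  have ty : t < y by rewrite (le_lt_trans _ xy)// le_max lexx orbT.
  have sy : s < y by rewrite (le_lt_trans _ xy)// le_max lexx.
  have y0 : 0 < y by exact: le_lt_trans ty.
  have Fy : flux q y = 0.
    have := z y; rewrite ty yr => /(_ isT)/eqP; rewrite mulf_eq0 invr_eq0.
    by rewrite (gt_eqF (fN_gt0 _)) ?orbF ?y0 ?ltW// => /eqP.
  have : f s ^+ N * q s = 0.
    apply: (deriv_ge0_eq0 (ltW y0) (F := flux q) (G := fun s => f s ^+ N * q s)).
    - by apply: within_continuous_subitv cF => //; exact: ltW.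
    - by move=> a /andP[a0 ay]; apply: dF; rewrite a0 (lt_trans ay).
    - move=> a /andP[a0 ay]; have ar : a <= r by rewrite ltW// (lt_trans ay).
      by apply: mulr_ge0; [rewrite ltW// fN_gt0// a0|rewrite q0// ltW].
    - by rewrite Fy F0.
    - by rewrite s1.
  by move/eqP; rewrite mulf_eq0 (gt_eqF (fN_gt0 _)) ?s1 ?ltW// => /eqP.
have : q s0 = 0.
  apply: (within_continuous_eq0 r_gt0 cq); last by rewrite in_itv.
  by move=> s; rewrite in_itv/=; exact: qz.
by move/eqP; rewrite (negbTE qs0).
Qed.

Lemma barta_quotientE n (u : R -> R) (t : R) : n.-1 = N ->
  {within `[0, r], continuous u} -> 0 <= t <= r ->
  barta_quotient n f r u t = u t / (potential u r - potential u t).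
Proof.
move=> nN cu /andP[t0 tr]; rewrite /barta_quotient nN; congr (_ / _).
have cs : {within `[0, r], continuous (slope u)} by exact: (@slope_continuous _ _ _ _ f1).
have ints (x y : R) (G : R -> R) : 0 <= x -> y <= r -> {within `[0, r], continuous G} ->
    mu.-integrable `[x, y] (EFin \o G).
  move=> x0 yr cG; apply: continuous_compact_integrable; first exact: segment_compact.
  exact: within_continuous_subitv cG.
transitivity (\int[mu]_(s in `[t, r]) slope u s).
  apply: eq_Rintegral => s; rewrite inE/= in_itv/= => /andP[ts sr].
  (* At s = 0 the factor 1/f(0) cannot be taken out of the integral; both sides are 0 there. *)
  have [s0|s0] := leP s 0.
    have -> : s = 0 by apply/eqP; rewrite eq_le s0 (le_trans t0).
    by rewrite set_itv1 Rintegral_set1 (@slope0 _ _ r).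
  rewrite /slope/radial_slope/radial_flux -RintegralZr//; last first.
    apply: ints => //.
    move=> x; apply: cvgM; last exact: cu.
    by apply: cvgXn; exact: cf.
  apply: eq_Rintegral => x _; rewrite expr_div_n; ring.
rewrite /radial_potential Rintegral_itvB; last 3 first.
- exact: ints.
- by rewrite bnd_simp.
- by rewrite bnd_simp.
rewrite Rintegral_itv_obnd_cbnd//.
apply: integrableS (ints t r (slope u) t0 (lexx r) cs) => //.
by apply: subset_itvr; rewrite bnd_simp.
Qed.

Section Comparison.
Variables (u p : R -> R) (lambda : R).
Hypothesis cu : {within `[0, r], continuous u}.
Hypothesis cp : {within `[0, r], continuous p}.
Hypothesis pE : forall t, 0 <= t <= r -> p t = 1 - potential (fun s => lambda * p s) t.
Hypothesis p_gt0 : forall t, 0 <= t < r -> 0 < p t.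
Hypothesis pr0 : p r = 0.
Let w t := potential u r - potential u t.
Let q s := lambda * p s.

Let cq : {within `[0, r], continuous q}.
Proof. by move=> t; apply: cvgM; [exact: cvg_cst|exact: cp]. Qed.

(* Boundary term of Green's identity for p and the solution w of the Poisson
   equation with right-hand side -u; it vanishes at both ends. *)
Let Z t := flux u t * p t - flux q t * w t.

Let Z_continuous : {within `[0, r], continuous Z}.
Proof.
have [_ cF _] := flux_prim cu; have [_ cG _] := flux_prim cq.
have [_ cW _] := pot_prim cu.
move=> t; apply: cvgB; apply: cvgM; [exact: cF|exact: cp|exact: cG|].
by apply: cvgB; [exact: cvg_cst|exact: cW].
Qed.

Let dZ t : 0 < t < r -> is_derive t 1 Z (f t ^+ N * p t * (u t - lambda * w t)).
Proof.
move=> /[dup] tr /andP[t0 t_r].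
have [_ _ /(_ _ tr) dF] := flux_prim cu; have [_ _ /(_ _ tr) dG] := flux_prim cq.
have [_ _ /(_ _ tr) dW] := pot_prim cu; have [_ _ /(_ _ tr) dV] := pot_prim cq.
have dw : is_derive t 1 w (- slope u t).
  by apply: is_derive_eq (is_deriveB (is_derive_cst (potential u r) t 1) dW) _; rewrite sub0r.
have dp : is_derive t 1 p (- slope q t).
  have d : is_derive t 1 (fun s => 1 - potential q s) (- slope q t).
    by apply: is_derive_eq (is_deriveB (is_derive_cst (1 : R) t 1) dV) _; rewrite sub0r.
  apply: near_eq_is_derive d; near=> s; rewrite pE//.
  by apply/andP; split; apply/ltW; near: s; [exact: lt_nbhsr|exact: lt_nbhsl].
(* The terms coming from p' and w' are both the product of the two fluxes divided by f^N, and
   cancel. *)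
apply: is_derive_eq (is_deriveB (is_derive_mul dF dp) (is_derive_mul dG dw)) _.
have fn0 : f t ^+ N != 0 by rewrite gt_eqF// fN_gt0// t0 ltW.
rewrite /slope/radial_slope /q; move: (flux _ t) (flux u t) (w t) => a b c.
by field.
Unshelve. all: by end_near. Qed.

Let Z0 : Z 0 = 0.
Proof.
have [F0 _ _] := flux_prim cu; have [G0 _ _] := flux_prim cq.
by rewrite /Z F0 G0 !mul0r subrr.
Qed.

Let Zr : Z r = 0. Proof. by rewrite /Z pr0 /w subrr !mulr0 subrr. Qed.

Let u_eq : (forall t, 0 < t < r -> f t ^+ N * p t * (u t - lambda * w t) = 0) ->
  forall t, 0 <= t <= r -> u t = lambda * w t.
Proof.
move=> H t tr; apply/eqP; rewrite -subr_eq0; apply/eqP.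
have [_ cW _] := pot_prim cu.
have c : {within `[0, r], continuous (fun t => u t - lambda * w t)}.
  move=> s; apply: cvgB; first exact: cu.
  apply: cvgM; first exact: cvg_cst.
  by apply: cvgB; [exact: cvg_cst|exact: cW].
apply: (within_continuous_eq0 r_gt0 c); last by rewrite in_itv.
move=> s; rewrite in_itv/= => /[dup] sr /andP[s0 s_r].
have /eqP := H _ sr; rewrite !mulf_eq0 (gt_eqF (fN_gt0 _)) ?s0 ?(ltW s_r)//.
by rewrite (gt_eqF (p_gt0 _)) ?(ltW s0) ?s_r//= => /eqP.
Qed.

Let weight_ge0 t : 0 < t < r -> 0 <= f t ^+ N * p t.
Proof.
move=> /andP[t0 tr]; rewrite mulr_ge0 ?ltW//; first by rewrite fN_gt0// t0 ltW.
by rewrite p_gt0// (ltW t0).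
Qed.

Lemma supersolution_eq : (forall t, 0 <= t < r -> lambda * w t <= u t) ->
  forall t, 0 <= t <= r -> u t = lambda * w t.
Proof.
move=> uw; apply: u_eq; apply: (deriv_ge0_eq0 (ltW r_gt0) Z_continuous dZ).
  move=> t /[dup] tr /andP[t0 t_r]; rewrite mulr_ge0 ?weight_ge0// subr_ge0 uw//.
  by rewrite ltW.
by rewrite Z0 Zr.
Qed.

Lemma subsolution_eq : (forall t, 0 <= t < r -> u t <= lambda * w t) ->
  forall t, 0 <= t <= r -> u t = lambda * w t.
Proof.
move=> uw; apply: u_eq => t tr.
have cNZ : {within `[0, r], continuous (fun t => - Z t)}.
  by move=> s; apply: cvgN; exact: Z_continuous.
have dNZ s : 0 < s < r -> is_derive s 1 (fun t => - Z t)
    (- (f s ^+ N * p s * (u s - lambda * w s))).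
  by move=> sr; apply: is_deriveN; exact: dZ.
apply/eqP; rewrite -oppr_eq0; apply/eqP; move: t tr.
apply: (deriv_ge0_eq0 (ltW r_gt0) cNZ dNZ).
  move=> t /[dup] tr /andP[t0 t_r]; rewrite -mulrN opprB mulr_ge0 ?weight_ge0// subr_ge0 uw//.
  by rewrite ltW.
by rewrite Z0 Zr.
Qed.

End Comparison.
End RadialBarta.

(** * A positive radial eigenfunction for the first eigenvalue *)

Section FirstEigenvalue.
Context {R : realType} {n : nat}.
Variables (Rad r : R) (f f1 : R -> R) (g : 'rV[R]_n -> 'M[R]_n).
Hypothesis n_gt0 : (0 < n)%N.
Hypothesis r_gt0 : 0 < r.
Hypothesis r_le : r <= Rad.
Hypothesis f0 : f 0 = 0.
Hypothesis cf : {within `[0, r], continuous f}.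
Hypothesis f_gt0 : forall t : R, 0 < t <= Rad -> 0 < f t.
Hypothesis df : forall t : R, 0 < t < r -> is_derive t 1 f (f1 t).
Hypothesis cf1 : forall t : R, 0 < t < r -> {for t, continuous f1}.
Hypothesis f1_0 : f1 t @[t --> 0^'+] --> (1 : R).
Hypothesis g_sym : spherically_symmetric g f Rad.
Local Notation potential := (radial_potential n.-1 f).

Let f_gt0' (t : R) : 0 < t <= r -> 0 < f t.
Proof. by move=> /andP[t0 tr]; apply: f_gt0; rewrite t0 (le_trans tr). Qed.

Lemma radial_dirichlet_eigenfunction (p : R -> R) (c lambda : R) :
  {within `[0, r], continuous p} ->
  (forall t : R, 0 <= t <= r -> p t = c - potential (fun s => lambda * p s) t) ->
  p 0 != 0 -> p r = 0 ->
  dirichlet_eigenfunction g r lambda (radial_extension p).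
Proof.
move=> cp pE p0 pr.
have cq : {within `[0, r], continuous (fun s => lambda * p s)}.
  by move=> t; apply: cvgM; [exact: cvg_cst|exact: cp].
split.
- exact: (radial_solution_C2 n_gt0 r_gt0 r_le f0 cf f_gt0 df cf1 f1_0 cq pE).
- exact: radial_within_continuous.
- exists 0; first by rewrite /geo_cball/= enorm0 ltW.
  by rewrite /radial_extension enorm0.
- move=> x xr.
  rewrite (radial_solution_laplace n_gt0 r_gt0 r_le f0 cf f_gt0 df f1_0 g_sym cq pE xr).
  by rewrite addNr.
- by move=> x; rewrite /geo_sphere/= /radial_extension => ->.
Qed.

Lemma first_eigenfunction_radial (lambda1 : R) : is_lambda1 g r lambda1 ->
  exists p : R -> R, [/\ {within `[0, r], continuous p},
    forall t : R, 0 <= t <= r -> p t = 1 - potential (fun s => lambda1 * p s) t,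
    forall t : R, 0 <= t < r -> 0 < p t & p r = 0] /\ 0 < lambda1.
Proof.
move=> [[v v_eig] lambda1_min].
have [C C0 CP] := power_warping_quasi_monotone n.-1 r_gt0 f0 cf f_gt0' df f1_0.
pose phi := radial_solution n.-1 f.
have cphi mu : {within `[0, r], continuous (phi mu)}.
  exact: (radial_solution_continuous r_gt0 f0 cf f_gt0' df f1_0 C0 CP).
have phiE mu (t : R) : 0 <= t <= r -> phi mu t = 1 - potential (fun s => mu * phi mu s) t.
  exact: (radial_solution_eq r_gt0 f0 cf f_gt0' df f1_0 C0 CP).
pose A := [set mu : R | 0 <= mu /\ forall t : R, 0 <= t <= r -> 0 < phi mu t].
have A0 : A 0.
  split=> // t _; rewrite /phi radial_solution_param0//.
have Aub : ubound A lambda1.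
  move=> mu [_ phi_gt0].
  exact: (positive_supersolution_bound n_gt0 r_gt0 r_le f0 cf f_gt0 df cf1 f1_0 g_sym
    (cphi mu) (phiE mu) phi_gt0 v_eig).
have supA : has_sup A by split; [exists 0|exists lambda1].
pose m := sup A.
have m_le : m <= lambda1 by apply: sup_le_ub => //; exists 0.
have m_ge0 : 0 <= m by exact: sup_upper_bound.
pose E (x : R) := expR (x * (C * r * r)).
have cE : {for m, continuous E}.
  have cl : (fun x => x * (C * r * r)) @ m --> m * (C * r * r) by exact: mulrr_continuous.
  exact: (cvg_comp _ _ cl (@continuous_expR R _)).
have near_E (e : R) : 0 < e -> exists2 d : R, 0 < d & forall x, `|m - x| < d -> `|E m - E x| <= e.
  move=> e0; have /cvgrPdist_le/(_ _ e0) := cE.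
  by move=> /nbhs_ballP[d /= d0 dP]; exists d.
have modulus (mu nu t : R) : 0 <= nu -> nu <= mu -> 0 <= t <= r ->
    `|phi mu t - phi nu t| <= E mu - E nu.
  exact: (radial_solution_modulus r_gt0 f0 cf f_gt0' df f1_0 C0 CP).
(* If phi_m(t) < 0, a parameter nu in [A] close enough to m moves the value at t by at most
   -phi_m(t), leaving phi_nu(t) <= 0. *)
have phi_ge0 t : 0 <= t <= r -> 0 <= phi m t.
  move=> tr; rewrite leNgt; apply/negP => ph.
  have e0 : 0 < - phi m t by rewrite oppr_gt0.
  have [d d0 dP] := near_E _ e0.
  have [nu [nu0 nuP] mnu] := sup_adherent d0 supA.
  have num : nu <= m by apply: sup_upper_bound.
  have := modulus _ _ _ nu0 num tr.
  have := dP nu; rewrite ger0_norm ?subr_ge0// ltrBlDl -ltrBlDr => /(_ mnu).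
  move=> h1 h2; have := le_trans h2 (le_trans (ler_norm _) h1).
  by rewrite ler_norml => /andP[+ _]; have := nuP _ tr; lra.
(* If the minimum of phi_m were positive, a slightly larger parameter would lower the solution by at
   most half of it everywhere and so still belong to [A]; uniformity of [modulus] in t is
   essential. *)
have [t0 t0r phit0] : exists2 t0, 0 <= t0 <= r & phi m t0 = 0.
  have [t0 t0r tmin] := EVT_min (ltW r_gt0) (cphi m).
  have t0r' : 0 <= t0 <= r by move: t0r; rewrite in_itv.
  exists t0 => //; apply/eqP; rewrite eq_le phi_ge0// andbT leNgt; apply/negP => pos.
  have e0 : 0 < phi m t0 / 2 by rewrite divr_gt0.
  have [d d0 dP] := near_E _ e0.
  have d2 : 0 < d / 2 by rewrite divr_gt0.
  have md : m <= m + d / 2 by rewrite lerDl ltW.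
  suff : A (m + d / 2) by move=> /(sup_upper_bound supA); rewrite leNgt ltrDl d2.
  split; first exact: le_trans md.
  move=> t tr; have := modulus _ _ _ m_ge0 md tr.
  have := dP (m + d / 2); rewrite opprD addrA subrr sub0r normrN gtr0_norm//.
  rewrite ltr_pdivrMr// ltr_pMr// ltr1n => /(_ isT); rewrite distrC => h1 h2.
  have := le_trans h2 (le_trans (ler_norm _) h1); rewrite ler_norml => /andP[+ _].
  by have := tmin t; rewrite in_itv/= => /(_ tr); lra.
have phi0 : phi m 0 = 1 by exact: (radial_solution0 r_gt0 f0 cf f_gt0' df f1_0 C0 CP).
have m_gt0 : 0 < m.
  rewrite lt_def m_ge0 andbT; apply/eqP => mE.
  by move: phit0 => /eqP; rewrite /phi mE radial_solution_param0// oner_eq0.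
have cq : {within `[0, r], continuous (fun s => m * phi m s)}.
  by move=> t; apply: cvgM; [exact: cvg_cst|exact: cphi].
have q_ge0 t : 0 <= t <= r -> 0 <= m * phi m t by move=> tr; rewrite mulr_ge0// phi_ge0.
have z0 : 0 <= (0 : R) <= r by rewrite lexx ltW.
have zr : 0 <= r <= r by rewrite lexx ltW.
have q_neq0 : exists2 s, 0 <= s <= r & m * phi m s != 0.
  by exists 0; rewrite // phi0 mulr1 gt_eqF.
have decr t : 0 <= t < r -> phi m r < phi m t.
  move=> tr; have tr' : 0 <= t <= r by case/andP: tr => -> /ltW.
  rewrite (phiE m t)// (phiE m r)// ltrD2l ltrN2.
  exact: (potential_lt n.-1 r_gt0 f0 cf f_gt0' df f1_0 cq q_ge0 q_neq0 tr).
have pos t : 0 <= t < r -> 0 < phi m t.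
  by move=> tr; exact: le_lt_trans (phi_ge0 _ zr) (decr _ tr).
have phir : phi m r = 0.
  have [t0lt|t0ge] := ltP t0 r.
    by have := pos t0; rewrite t0lt phit0 ltxx; case/andP: t0r => -> _ /(_ isT).
  by rewrite -phit0; congr (phi m _); apply/eqP; rewrite eq_le t0ge; case/andP: t0r.
have mE : lambda1 = m.
  apply/eqP; rewrite eq_le m_le andbT; apply: lambda1_min.
  exists (radial_extension (phi m)).
  apply: (radial_dirichlet_eigenfunction (cphi m) (phiE m)) => //.
  by rewrite phi0 oner_neq0.
by exists (phi m); rewrite mE; split => //; split => //; exact: phiE.
Qed.

End FirstEigenvalue.

(** * Derivatives relative to an interval *)

Section WithinDerivatives.
Context {R : realType}.
Implicit Types (f : R -> R).

Lemma is_derive_within_continuous (A : set R) f (f1 : R -> R) :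
  (forall x, A x -> is_derive_within A f x (f1 x)) -> {within A, continuous f}.
Proof.
move=> df; apply/subspace_continuousP => x Ax.
have c : f y @[y --> within A x^'] --> f x.
  have : (f y - f x) / (y - x) * (y - x) + f x @[y --> within A x^'] --> f1 x * 0 + f x.
    apply: cvgD; last exact: cvg_cst.
    apply: cvgM; first exact: df.
    rewrite -(subrr x); apply: cvgB; last exact: cvg_cst.
    by apply: cvg_within_filter; apply: cvg_within_filter; exact: cvg_id.
  rewrite mulr0 add0r; apply: cvg_trans; apply: near_eq_cvg.
  rewrite near_withinE; near=> y => _.
  rewrite divfK ?subrK// subr_eq0; near: y; exact: nbhs_dnbhs_neq.
apply/cvgrPdist_le => e e0; move/cvgrPdist_le/(_ _ e0) : c.
rewrite !near_withinE; apply: filterS => y H Ay.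
by have [->|/H/(_ Ay)//] := eqVneq y x; rewrite subrr normr0 ltW.
Unshelve. all: by end_near. Qed.

Lemma is_derive_within_interior (a b t l : R) f : a < t < b ->
  is_derive_within `[a, b] f t l -> is_derive t 1 f l.
Proof.
move=> /andP[at_ tb] d.
have {}d : (f y - f t) / (y - t) @[y --> t^'] --> l.
  apply/cvgrPdist_le => e e0; move/cvgrPdist_le/(_ _ e0) : d; rewrite near_withinE => d.
  have ab : \forall y \near t^', `[a, b]%classic y.
    apply: cvg_within; have : \forall y \near t, a < y < b.
      by near=> y; apply/andP; split; near: y; [exact: lt_nbhsr|exact: lt_nbhsl].
    by apply: filterS => y /andP[ay yb]; rewrite /= in_itv/= !ltW.
  by apply: filterS2 ab d => y yab; apply.
apply/is_derive1_caratheodory.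
exists (fun y => if y == t then l else (f y - f t) / (y - t)); split.
- move=> z; case: eqVneq => [->|zt]; first by rewrite !subrr mulr0.
  by rewrite divfK// subr_eq0.
- apply/continuous_withinNx; rewrite eqxx; apply: cvg_trans d.
  apply: near_eq_cvg; near=> y; rewrite ifN//.
  by near: y; exact: nbhs_dnbhs_neq.
- by rewrite eqxx.
Unshelve. all: by end_near. Qed.

Lemma is_derive_within_at_right (a b l : R) f : a < b ->
  is_derive_within `[a, b] f a l -> (f y - f a) / (y - a) @[y --> a^'+] --> l.
Proof.
move=> ab /cvgrPdist_le d; apply/cvgrPdist_le => e e0.
have := d _ e0; rewrite !near_withinE => -[/= k k0 kP].
have yk : \forall y \near a, `|a - y| < k by exact: nbhsx_ballx.
have yb : \forall y \near a, y < b by exact: lt_nbhsl.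
near=> y => ay; apply: kP => /=; first by near: y.
  by rewrite gt_eqF.
by rewrite in_itv/= ltW//= ltW//; near: y.
Unshelve. all: by end_near. Qed.

End WithinDerivatives.

Theorem theorem1p2 (R : realType) (n : nat) (Rad r : R) (f : R -> R)
    (g : 'rV[R]_n -> 'M[R]_n) (lambda1 : R) (u : R -> R)
    (n_gt0 : (0 < n)%N)
    (f_C2 : C2_within `[0, Rad] f)
    (f0 : f 0 = 0)
    (f'0 : is_derive_within `[0, Rad] f 0 1)
    (f_gt0 : forall t, 0 < t <= Rad -> 0 < f t)
    (g_sym : spherically_symmetric g f Rad)
    (r_gt0 : 0 < r) (r_le : r <= Rad)
    (lambda1P : is_lambda1 g r lambda1)
    (u_cont : {within `[0, r], continuous u})
    (u_ge0 : forall t, 0 <= t <= r -> 0 <= u t)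
    (u_neq0 : exists2 t, 0 <= t <= r & u t != 0) :
  let h := barta_quotient n f r u in
  let sup_h := ereal_sup [set (h t)%:E | t in `[0, r[] in
  let inf_h := ereal_inf [set (h t)%:E | t in `[0, r[] in
  let equality_case :=
    positive_first_eigenfunction g r (radial_extension u) /\
    (forall t, 0 <= t < r -> lambda1 = h t) in
  [/\ (lambda1%:E <= sup_h)%E,
      (inf_h <= lambda1%:E)%E,
      sup_h = lambda1%:E <-> equality_case
    & inf_h = lambda1%:E <-> equality_case].
Proof.
have Rad_gt0 : 0 < Rad by exact: lt_le_trans r_le.
have [f1 [f2 [dwf dwf1 _]]] := f_C2.
have cfR := is_derive_within_continuous dwf.
have cf1R := is_derive_within_continuous dwf1.
(* [f_C2] and [f'0] each provide a derivative at 0; they agree by uniqueness of the one-sided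
   limit. *)
have f1_at0 : f1 0 = 1.
  have d0 : is_derive_within `[0, Rad] f 0 (f1 0).
    by apply: dwf; rewrite /= in_itv/= lexx ltW.
  have l1 := is_derive_within_at_right Rad_gt0 d0.
  have l2 := is_derive_within_at_right Rad_gt0 f'0.
  exact: (cvg_unique (@Rhausdorff R) l1 l2).
have f1_0 : f1 t @[t --> 0^'+] --> (1 : R).
  by rewrite -f1_at0; move: cf1R; rewrite continuous_within_itvP// => -[].
have cf : {within `[0, r], continuous f} by exact: within_continuous_subitv cfR.
have in_Rad (t : R) : 0 < t < r -> 0 < t < Rad.
  by move=> /andP[-> tr]; exact: lt_le_trans r_le.
have df (t : R) : 0 < t < r -> is_derive t 1 f (f1 t).
  move=> /in_Rad /[dup] tR /andP[t0 t1]; apply: (is_derive_within_interior tR).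
  by apply: dwf; rewrite /= in_itv/= !ltW.
have cf1 (t : R) : 0 < t < r -> {for t, continuous f1}.
  by move=> /in_Rad tR; exact: within_continuous_at tR cf1R.
have f_gt0' (t : R) : 0 < t <= r -> 0 < f t.
  by move=> /andP[t0 tr]; apply: f_gt0; rewrite t0 (le_trans tr).
have [p [[cp pE p_gt0 pr] lambda1_gt0]] :=
  first_eigenfunction_radial n_gt0 r_gt0 r_le f0 cf f_gt0 df cf1 f1_0 g_sym lambda1P.
pose w t := radial_potential n.-1 f u r - radial_potential n.-1 f u t.
have w_gt0 t : 0 <= t < r -> 0 < w t.
  move=> tr; rewrite subr_gt0.
  exact: (potential_lt n.-1 r_gt0 f0 cf f_gt0' df f1_0 u_cont u_ge0 u_neq0 tr).
move=> h sup_h inf_h equality_case.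
have hE t : 0 <= t < r -> h t = u t / w t.
  move=> /andP[t0 tr].
  by apply: (barta_quotientE r_gt0 f0 cf f_gt0' df f1_0 (erefl n.-1) u_cont); rewrite t0 ltW.
have eq_case : (forall t, 0 <= t <= r -> u t = lambda1 * w t) -> equality_case.
  move=> uE; have u_pos t : 0 <= t < r -> 0 < u t.
    by move=> /[dup] tr /andP[t0 /ltW tr']; rewrite uE ?t0// mulr_gt0// w_gt0.
  split; last first.
    move=> t tr; rewrite hE// uE; last by case/andP: tr => -> /ltW.
    by rewrite mulfK// gt_eqF// w_gt0.
  split; last by move=> x xr; apply: u_pos; rewrite enorm_ge0.
  exists lambda1 => //.
  (* From u = lambda1 w with w = W(r) - W, the function u solves its own eigenvalue equation in
     integrated form, with constant c = lambda1 W(r) = u(0). *)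
  apply: (radial_dirichlet_eigenfunction n_gt0 r_gt0 r_le f0 cf f_gt0 df cf1 f1_0 g_sym
    (c := lambda1 * radial_potential n.-1 f u r) u_cont).
  - move=> t tr; rewrite (potentialZ n.-1 r_gt0 f0 cf f_gt0' df f1_0 lambda1 u_cont tr).
    by rewrite uE// mulrBr.
  - by rewrite gt_eqF// u_pos// lexx.
  - by rewrite uE ?lexx ?ltW// /w subrr mulr0.
have h_le t : 0 <= t < r -> ((h t)%:E <= sup_h)%E.
  by move=> tr; apply: ereal_sup_ubound; exists t => //; rewrite /= in_itv.
have h_ge t : 0 <= t < r -> (inf_h <= (h t)%:E)%E.
  by move=> tr; apply: ereal_inf_lbound; exists t => //; rewrite /= in_itv.
(* An upper bound lambda1 for h is the pointwise inequality u <= lambda1 w, and a lower bound is the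
   reverse one; each collapses to equality. *)
have sup_case : (sup_h <= lambda1%:E)%E -> equality_case.
  move=> sup_le; apply: eq_case.
  apply: (subsolution_eq (N := n.-1) r_gt0 f0 cf f_gt0' df f1_0 u_cont cp pE p_gt0 pr) => t tr.
  rewrite -ler_pdivrMr ?w_gt0// -hE// -lee_fin.
  exact: le_trans (h_le _ tr) sup_le.
have inf_case : (lambda1%:E <= inf_h)%E -> equality_case.
  move=> inf_ge; apply: eq_case.
  apply: (supersolution_eq (N := n.-1) r_gt0 f0 cf f_gt0' df f1_0 u_cont cp pE p_gt0 pr) => t tr.
  rewrite -ler_pdivlMr ?w_gt0// -hE// -lee_fin.
  exact: le_trans inf_ge (h_ge _ tr).
have case_eq : equality_case -> sup_h = lambda1%:E /\ inf_h = lambda1%:E.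
  move=> [_ hl]; rewrite /sup_h /inf_h.
  rewrite (_ : [set _ | _ in _] = [set lambda1%:E]) ?ereal_sup1 ?ereal_inf1//.
  apply/seteqP; split => [_ [t tr <-]|_ ->] /=.
    by rewrite -hl//; rewrite /= in_itv in tr.
  exists 0; first by rewrite /= in_itv/= lexx.
  by rewrite -hl// lexx.
(* The inequalities follow from the equality analysis: a strict violation would already imply the
   equality case, in which the supremum and the infimum both equal lambda1. *)
split.
- rewrite leNgt; apply/negP => lt.
  by have [E _] := case_eq (sup_case (ltW lt)); rewrite E ltxx in lt.
- rewrite leNgt; apply/negP => lt.
  by have [_ E] := case_eq (inf_case (ltW lt)); rewrite E ltxx in lt.
- by split=> [E|/case_eq[]//]; apply: sup_case; rewrite E.
- by split=> [E|/case_eq[]//]; apply: inf_case; rewrite E.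
Qed.
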